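(* For any graph $G$ and any field $\mathbb{k}$, $$\operatorname{proj-dim}_{\mathbb{k}}(G)=\max\Big\{\sum_{i=1}^{r}\operatorname{proj-dim}_{\mathbb{k}}(H_i)\colon \{H_1,\ldots,H_r\}\in \mathcal{PD}_{\mathbb{k}}(G)\Big\},$$ where $\mathcal{PD}_{\mathbb{k}}(G)$ is the set of projectively prime decompositions of $G$ over $\mathbb{k}$.
   Context: Graphs are finite, without loops or multiple edges. For a field $\mathbb{k}$ and a graph $G$ on $V$, $\operatorname{proj-dim}_{\mathbb{k}}(G):=\operatorname{proj-dim}(R/I_G)$, where $R=\mathbb{k}[V]$ and $I_G=(xy:xy\in E(G))$ is the edge ideal. A connected graph $G$ is projectively prime over $\mathbb{k}$ if $\operatorname{proj-dim}_{\mathbb{k}}(G-x)<\operatorname{proj-dim}_{\mathbb{k}}(G)$ for every vertex $x\in V(G)$. Let $\mathcal{R}=\{R_1,\ldots,R_r\}$ be a set of pairwise vertex disjoint induced subgraphs of $G$ such that $|V(R_i)|\ge 2$ for each $i$. Then $\mathcal{R}$ is an induced decomposition of $G$ if the induced subgraph of $G$ on $\bigcup_{i=1}^r V(R_i)$ contains no edge of $G$ that is not contained in any of the $E(R_i)$, and $\mathcal{R}$ is maximal with this property. An induced decomposition $\mathcal{R}=\{R_1,\ldots,R_r\}$ of $G$ is a projectively prime decomposition of $G$ over $\mathbb{k}$ if each $R_i$ is a projectively prime graph over $\mathbb{k}$.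
   Formalization: Members of an induced decomposition are required to be connected, also when testing maximality, and the empty family is allowed; with arbitrary induced subgraphs the claim fails, e.g. for K_2 plus two isolated vertices no projectively prime decomposition exists. *)

(* Defs.v *)
From HB Require Import structures.
From mathcomp Require Import all_boot all_order all_algebra.
From mathcomp Require Import generic_quotient ring_quotient boolp mpoly.

Set Implicit Arguments.
Unset Strict Implicit.
Unset Printing Implicit Defensive.

Import GRing.Theory.
Local Open Scope ring_scope.

Record sgraph := SGraph {
  vertex :> finType;
  edge : rel vertex;
  edge_sym : ssrbool.symmetric edge;
  edge_irr : irreflexive edge
}.

Section InducedSubgraph.
Variables (G : sgraph) (S : {set G}).

Definition induced_edge : rel {x : G | x \in S} :=
  fun u v => edge (val u) (val v).

Lemma induced_edge_sym : ssrbool.symmetric induced_edge.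
Proof. by move=> u v; apply: edge_sym. Qed.

Lemma induced_edge_irr : irreflexive induced_edge.
Proof. by move=> u; apply: edge_irr. Qed.

Definition induced : sgraph := SGraph induced_edge_sym induced_edge_irr.

End InducedSubgraph.

Definition delete_vertex (G : sgraph) (x : G) : sgraph := induced [set~ x].

Definition connected_graph (G : sgraph) : Prop :=
  (0 < #|G|)%N /\ forall x y : G, connect (@edge G) x y.

Section QuotientModule.
Variables (R : comNzRingType) (I : idealr R).
Local Open Scope quotient_scope.

Definition quot_scale (a : R) (x : {ideal_quot I}) : {ideal_quot I} :=
  \pi_({ideal_quot I}) a * x.

Lemma quot_scaleA a b x :
  quot_scale a (quot_scale b x) = quot_scale (a * b) x.
Proof. by rewrite /quot_scale rmorphM mulrA. Qed.

Lemma quot_scale1 : left_id 1 quot_scale.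
Proof. by move=> x; rewrite /quot_scale rmorph1 mul1r. Qed.

Lemma quot_scaleDr : right_distributive quot_scale +%R.
Proof. by move=> a x y; rewrite /quot_scale mulrDr. Qed.

Lemma quot_scaleDl x : {morph quot_scale^~ x : a b / a + b}.
Proof. by move=> a b; rewrite /quot_scale rmorphD mulrDl. Qed.

HB.instance Definition _ := GRing.Zmodule_isLmodule.Build R {ideal_quot I}
  quot_scaleA quot_scale1 quot_scaleDr quot_scaleDl.

End QuotientModule.

Section ProjectiveDimension.
Variable R : nzRingType.

Definition projective (P : lmodType R) : Prop :=
  forall (M N : lmodType R) (g : {linear M -> N}) (f : {linear P -> N}),
    (forall y, exists x, g x = y) ->
    exists h : {linear P -> M}, forall p, g (h p) = f p.

(* 0 -> P_n -> ... -> P_1 -> P_0 -> M -> 0 is an exact complex of projectives,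
   written as an infinite complex with P_i = 0 for i > n. *)
Definition has_projective_resolution (M : lmodType R) (n : nat) : Prop :=
  exists (P : nat -> lmodType R)
         (d : forall i, {linear P i.+1 -> P i})
         (eps : {linear P 0 -> M}),
  [/\ forall i, projective (P i),
      forall m, exists p, eps p = m,
      forall p, eps p = 0 <-> exists q, d 0 q = p,
      forall i p, d i p = 0 <-> exists q, d i.+1 q = p &
      forall i, (n < i)%N -> forall p : P i, p = 0].

(* The value is 0 by convention when M has no finite projective resolution,
   which never occurs for modules over a polynomial ring in finitely many
   variables over a field (Hilbert's syzygy theorem). *)
Definition proj_dim (M : lmodType R) : nat :=
  if pselect (exists n, `[< has_projective_resolution M n >]) is left ex
  then ex_minn ex else 0.

End ProjectiveDimension.

Section EdgeIdeal.
Variables (k : fieldType) (G : sgraph).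

Local Notation vertex_ring := {mpoly k[#|G|]}.

Definition vertex_var (x : G) : vertex_ring := 'X_(enum_rank x).

(* the ideal generated by the products xy, for xy an edge *)
Definition edge_ideal : {pred vertex_ring} := fun p =>
  `[< exists c : G -> G -> vertex_ring,
        p = \sum_x \sum_(y | edge x y) c x y * (vertex_var x * vertex_var y) >].

Lemma edge_ideal_idealr_closed : idealr_closed edge_ideal.
Proof.
split.
- apply/asboolP; exists (fun _ _ => 0).
  by rewrite big1 // => x _; rewrite big1 // => y _; rewrite mul0r.
- apply/negP => /asboolP[c] /(congr1 (meval (fun=> 0))) /eqP.
  rewrite rmorph1 raddf_sum big1 ?oner_eq0 // => x _.
  rewrite raddf_sum big1 // => y _.
  by rewrite /= !mevalM mevalXU mul0r mulr0.
move=> a p q /asboolP[c ->] /asboolP[c' ->]; apply/asboolP.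
exists (fun x y => a * c x y + c' x y).
rewrite mulr_sumr -big_split; apply: eq_bigr => x _ /=.
rewrite mulr_sumr -big_split; apply: eq_bigr => y _ /=.
by rewrite mulrDl -mulrA.
Qed.

HB.instance Definition _ :=
  isIdealr.Build vertex_ring edge_ideal edge_ideal_idealr_closed.

Definition edge_ring : lmodType vertex_ring := {ideal_quot edge_ideal}.

Definition graph_proj_dim : nat := proj_dim edge_ring.

End EdgeIdeal.

Definition projectively_prime (k : fieldType) (G : sgraph) : Prop :=
  connected_graph G /\
  forall x : G,
    (graph_proj_dim k (delete_vertex x) < graph_proj_dim k G)%N.

(* An induced subgraph is given by its vertex set. The subgraphs of a
   decomposition are taken to be connected: if disconnected (in particular
   edgeless) subgraphs were admitted in the maximality condition, then a graph
   such as K_2 with two isolated vertices, or an edgeless graph on at least two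
   vertices, would have no decomposition into connected subgraphs at all. *)
Definition induced_family (G : sgraph) (D : {set {set G}}) : Prop :=
  [/\ trivIset D,
      forall S, S \in D -> (2 <= #|S|)%N,
      forall S, S \in D -> connected_graph (induced S) &
      forall x y, x \in cover D -> y \in cover D -> edge x y ->
        exists2 S, S \in D & (x \in S) && (y \in S)].

Definition induced_decomposition (G : sgraph) (D : {set {set G}}) : Prop :=
  induced_family D /\
  forall D' : {set {set G}}, induced_family D' -> D \subset D' -> D' = D.

Definition projectively_prime_decomposition
    (k : fieldType) (G : sgraph) (D : {set {set G}}) : Prop :=
  induced_decomposition D /\
  forall S, S \in D -> projectively_prime k (induced S).

Definition is_maximum (A : nat -> Prop) (m : nat) : Prop :=
  A m /\ forall n, A n -> (n <= m)%N.

(* Main.v *)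
(* Let [R = k[V(G)]] and [I] be the edge ideal. The Taylor complex is a free
   resolution of [R/I] with basis the sets [s] of edges, [s] having multidegree
   the union [cover s]. Reducing it modulo the variables leaves a complex over
   [k] in which only the faces with the same cover survive, and the projective
   dimension is the top degree of the homology of that scalar complex:
   - a contraction of the scalar complex above degree [n] lifts to the Taylor
     complex up to an operator that strictly shrinks covers, hence up to a
     nilpotent one, so the Taylor complex can be truncated at degree [n];
   - a resolution of length [m] yields a contraction of the Taylor complex above
     degree [m], which kills the homology of its reduction above degree [m].
   The scalar complex of an induced subgraph is a direct summand of that of the
   graph, and the scalar complex of a disjoint union without cross edges is a
   tensor product. So the projective dimension is monotone under induced
   subgraphs and additive over such unions. Take a smallest vertex set [W] with
   the projective dimension of [G]: by minimality and additivity its components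
   are projectively prime; a further member of the family would contain an edge
   and make the projective dimension exceed that of [G]. *)

Require Import Defs.
From HB Require Import structures.
From mathcomp Require Import all_boot all_order all_algebra.
From mathcomp Require Import ring zify.
From mathcomp Require Import generic_quotient ring_quotient boolp mpoly.

Set Implicit Arguments.
Unset Strict Implicit.
Unset Printing Implicit Defensive.

Import GRing.Theory.
Local Open Scope ring_scope.

(** * Modules, projective lifting and comparison of resolutions *)

Section KernelModule.
Variables (R : nzRingType) (X Y : lmodType R) (f : {linear X -> Y}).

Definition ker_pred : {pred X} := [pred x | f x == 0].

Lemma ker_submod_closed : submod_closed ker_pred.
Proof.
split; first by rewrite inE raddf0.
by move=> a u v; rewrite !inE linearP => /eqP-> /eqP->; rewrite scaler0 addr0.
Qed.

HB.instance Definition _ := GRing.isSubmodClosed.Build R X ker_pred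
  ker_submod_closed.

Definition kermod := {x : X | x \in ker_pred}.

HB.instance Definition _ := SubChoice.on kermod.
HB.instance Definition _ := [SubChoice_isSubLmodule of kermod by <:].

Lemma kermodP (u : kermod) : f (val u) = 0.
Proof. by have := valP u; rewrite inE => /eqP. Qed.

Definition kermod_sub (x : X) (fx : f x = 0) : kermod :=
  exist _ x (introT eqP fx : x \in ker_pred).

End KernelModule.

Lemma linear_of (R : nzRingType) (X Y : lmodType R) (f : X -> Y) :
  linear f -> exists g : {linear X -> Y}, g =1 f.
Proof.
move=> fL; pose L := GRing.isLinear.Build R X Y *:%R f fL.
by exists (HB.pack f L : {linear X -> Y}).
Qed.

(** [projective] lifts only along maps onto the whole target. The kernel of [(p, x) |-> phi p - g x]
    is the fibre product of [phi] and [g]; it surjects onto [P], and a section of that surjection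
    contains the lift. *)
Lemma proj_lift (R : nzRingType) (P M L : lmodType R)
    (phi : {linear P -> L}) (g : {linear M -> L}) :
  projective P -> (forall p, exists x, g x = phi p) ->
  exists h : {linear P -> M}, forall p, g (h p) = phi p.
Proof.
move=> projP gphi.
have [dif difE] : exists dif : {linear (P * M)%type -> L},
    dif =1 (fun u => phi u.1 - g u.2).
  apply: linear_of => a u v /=.
  rewrite (linearP phi) (linearP g).
  by rewrite scalerBr opprD addrACA.
pose pr : {linear kermod dif -> P} := (fst \o val)%FUN.
have [|h hE] := projP _ _ pr (idfun : {linear P -> P}).
  move=> p; have [x gx] := gphi p.
  have Kpx : dif (p, x) = 0 by rewrite difE gx subrr.
  by exists (kermod_sub Kpx).
exists ((snd \o val)%FUN \o h)%FUN => p /=.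
have := kermodP (h p); rewrite difE => /eqP; rewrite subr_eq0 => /eqP <-.
by congr (phi _); apply: hE.
Qed.

(** Dependent choice when the type varies with the index; the invariant [inv] is what makes the next
    term available. *)
Lemma dep_seq (X : nat -> Type) (inv : forall i, X i -> Prop)
    (Q : forall i, X i -> X i.+1 -> Prop) (x0 : X 0%N) :
  inv 0%N x0 ->
  (forall i x, inv i x -> exists y, inv i.+1 y /\ Q i x y) ->
  exists s : forall i, X i, s 0%N = x0 /\ forall i, Q i (s i) (s i.+1).
Proof.
move=> inv0 step.
pose s := fix s i : {x : X i | inv i x} := match i with
  | 0%N => exist _ x0 inv0
  | j.+1 => let x := s j in let y := cid (step j (sval x) (svalP x)) in
            exist _ (sval y) (proj1 (svalP y)) end.
exists (fun i => sval (s i)); split=> // i.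
exact: (proj2 (svalP (cid (step i (sval (s i)) (svalP (s i)))))).
Qed.

Section Comparison.
Variables (R : nzRingType) (M : lmodType R).
Variables (P Q : nat -> lmodType R).
Variables (dP : forall i, {linear P i.+1 -> P i}) (eP : {linear P 0%N -> M}).
Variables (dQ : forall i, {linear Q i.+1 -> Q i}) (eQ : {linear Q 0%N -> M}).
Hypothesis projP : forall i, projective (P i).
Hypothesis edP : forall p, eP (dP 0 p) = 0.
Hypothesis ddP : forall i p, dP i (dP i.+1 p) = 0.
Hypothesis eQsurj : forall m, exists q, eQ q = m.
Hypothesis exQ0 : forall q, eQ q = 0 -> exists q', dQ 0 q' = q.
Hypothesis exQ : forall i q, dQ i q = 0 -> exists q', dQ i.+1 q' = q.

(** The augmentation serves as the differential out of degree zero. *)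
Definition is_cycle i : Q i -> Prop :=
  match i with 0%N => fun q => eQ q = 0 | j.+1 => fun q => dQ j q = 0 end.

Lemma cycle_boundary i (q : Q i) : is_cycle q -> exists q', dQ i q' = q.
Proof. by case: i q => [|i] q /=; [apply: exQ0 | apply: exQ]. Qed.

Lemma comparison :
  exists f : forall i, {linear P i -> Q i},
    (forall p, eQ (f 0%N p) = eP p) /\
    forall i p, dQ i (f i.+1 p) = f i (dP i p).
Proof.
have [f0 f0E] : exists f0 : {linear P 0%N -> Q 0%N},
    forall p, eQ (f0 p) = eP p.
  by apply: (proj_lift (@projP 0%N)) => p; apply: eQsurj.
have [||f [f0' fE]] := @dep_seq (fun i => {linear P i -> Q i})
  (fun i f => forall p, is_cycle (f (dP i p)))
  (fun i f g => forall p, dQ i (g p) = f (dP i p)) f0.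
- by move=> p /=; rewrite f0E edP.
- move=> i f fcyc.
  have [|g gE] := proj_lift (g := dQ i) (phi := (f \o dP i)%FUN) (@projP i.+1).
    by move=> p; apply: cycle_boundary; apply: fcyc.
  exists g; split=> //= p; rewrite gE /=.
  by rewrite ddP raddf0.
by exists f; split=> // p; rewrite f0'.
Qed.

(** Such an [h] lifts the zero map. The homotopy is built degree by degree: [h i.+1 - s i d] is a
    cycle, hence a boundary, and projectivity lifts it. *)
Lemma null_homotopy (h : forall i, {linear P i -> Q i}) :
  (forall p, eQ (h 0%N p) = 0) ->
  (forall i p, dQ i (h i.+1 p) = h i (dP i p)) ->
  exists s : forall i, {linear P i -> Q i.+1},
    forall i p, h i.+1 p = dQ i.+1 (s i.+1 p) + s i (dP i p).
Proof.
move=> h0 hE.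
have [s0 s0E] : exists s0 : {linear P 0%N -> Q 1%N},
    forall p, dQ 0 (s0 p) = h 0%N p.
  by apply: (proj_lift (@projP 0%N)) => p; apply: exQ0.
have [||s [_ sE]] := @dep_seq (fun i => {linear P i -> Q i.+1})
  (fun i s => forall p, dQ i (s (dP i p)) = h i (dP i p))
  (fun i s s' => forall p, dQ i.+1 (s' p) = h i.+1 p - s (dP i p)) s0.
- by move=> p; rewrite s0E.
- move=> i s sE.
  have [|g gE] := proj_lift (g := dQ i.+1)
      (phi := (h i.+1 \- (s \o dP i)%FUN) : {linear _ -> _}) (@projP i.+1).
    by move=> p; apply: exQ; rewrite /= raddfB /= hE sE subrr.
  exists g; split=> //= p; rewrite gE /=.
  by rewrite ddP raddf0 subr0.
by exists s => i p; rewrite sE addrNK.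
Qed.

End Comparison.

(** Compare [F] with the short resolution [P] in both directions. The map [id - g f] lifts zero, so
    it is null-homotopic; above degree [m] the module of [P] vanishes, so [f] does too and the
    homotopy contracts [F]. *)
Lemma resolution_contraction (R : nzRingType) (M : lmodType R) (m : nat)
    (F : nat -> lmodType R) (d : forall i, {linear F i.+1 -> F i})
    (eps : {linear F 0%N -> M}) :
  has_projective_resolution M m ->
  (forall i, projective (F i)) ->
  (forall x, exists p, eps p = x) ->
  (forall p, eps p = 0 <-> exists q, d 0 q = p) ->
  (forall i p, d i p = 0 <-> exists q, d i.+1 q = p) ->
  exists s : forall i, {linear F i -> F i.+1},
    forall i, (m <= i)%N -> forall p : F i.+1,
      p = d i.+1 (s i.+1 p) + s i (d i p).
Proof.
case=> [P [dP [eP [projP surjP ex0P exP zP]]]] projF surjF ex0F exF.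
have edP p : eP (dP 0 p) = 0 by apply/ex0P; exists p.
have ddP i p : dP i (dP i.+1 p) = 0 by apply/exP; exists p.
have edF p : eps (d 0 p) = 0 by apply/ex0F; exists p.
have ddF i p : d i (d i.+1 p) = 0 by apply/exF; exists p.
have [f [f0 fE]] : exists f : forall i, {linear F i -> P i},
    (forall p, eP (f 0%N p) = eps p) /\
    forall i p, dP i (f i.+1 p) = f i (d i p).
  apply: comparison => //; first by move=> q /ex0P.
  by move=> i q /exP.
have [g [g0 gE]] : exists g : forall i, {linear P i -> F i},
    (forall p, eps (g 0%N p) = eP p) /\
    forall i p, d i (g i.+1 p) = g i (dP i p).
  apply: comparison => //; first by move=> q /ex0F.
  by move=> i q /exF.
have exF0 q : eps q = 0 -> exists q', d 0 q' = q by move=> /ex0F.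
have exF' i q : d i q = 0 -> exists q', d i.+1 q' = q by move=> /exF.
have [||s sE] := null_homotopy projF ddF exF0 exF'
  (h := fun i => (idfun \- (g i \o f i)%FUN) : {linear F i -> F i}).
- by move=> p; rewrite /= raddfB /= g0 f0 subrr.
- by move=> i p; rewrite /= raddfB /= gE fE.
exists s => i lemi p; rewrite -sE /=.
by rewrite [f i.+1 p]zP // raddf0 subr0.
Qed.

(** * Resolutions given by square matrices *)

Section MatrixResolution.
Variables (R : comNzRingType) (N : nat).

(** For an idempotent [e] this is the row space of [e], a direct summand of the free module; as the
    kernel of [1 - e] it inherits its module structure from [kermod]. *)
Definition fixmod (e : 'M[R]_N) : lmodType R :=
  kermod (mulmxr (1%:M - e) : {linear 'rV[R]_N -> 'rV[R]_N}).

Definition fixmod_val e : {linear fixmod e -> 'rV[R]_N} :=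
  (val : {linear kermod _ -> _}).

Definition fval e (u : fixmod e) : 'rV[R]_N := fixmod_val e u.

Lemma fval_linear e c (x y : fixmod e) :
  fval (c *: x + y) = c *: fval x + fval y.
Proof. exact: linearP. Qed.

Lemma fvalD e (x y : fixmod e) : fval (x + y) = fval x + fval y.
Proof. exact: raddfD. Qed.

Lemma fval_inj e : injective (@fval e).
Proof. exact: val_inj. Qed.

Lemma fixmodP e (u : fixmod e) : fval u *m e = fval u.
Proof.
apply/eqP; rewrite eq_sym -subr_eq0; apply/eqP.
by have := kermodP u; rewrite /= mulmxBr mulmx1.
Qed.

Lemma fixmod_sub_subproof (e : 'M[R]_N) (v : 'rV[R]_N) : v *m e = v ->
  mulmxr (1%:M - e) v = 0.
Proof. by move=> ve; rewrite /= mulmxBr mulmx1 ve subrr. Qed.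

Definition fixmod_sub (e : 'M[R]_N) (v : 'rV[R]_N) (ve : v *m e =
  v) : fixmod e :=
  kermod_sub (fixmod_sub_subproof ve).

(** A lift on a summand of a free module is obtained by lifting the images of the projected basis
    vectors and extending linearly. *)
Lemma fixmod_projective e : e *m e = e -> projective (fixmod e).
Proof.
move=> ee A B g f gsurj.
have inF (v : 'rV[R]_N) : (v *m e) *m e = v *m e by rewrite -mulmxA ee.
pose x (i : 'I_N) : A :=
  sval (cid (gsurj (f (fixmod_sub (inF (delta_mx 0 i)))))).
have xE i : g (x i) = f (fixmod_sub (inF (delta_mx 0 i))).
  by rewrite /x; case: cid.
have [|h hE] := @linear_of R (fixmod e) A (fun u => \sum_i fval u 0 i *: x i).
  move=> a u v; rewrite scaler_sumr -big_split; apply: eq_bigr => i _ /=.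
  by rewrite /fval linearP !mxE scalerDl scalerA.
exists h => u; rewrite hE raddf_sum /=.
transitivity (f (\sum_i fval u 0 i *: fixmod_sub (inF (delta_mx 0 i)))).
  rewrite !raddf_sum; apply: eq_bigr => i _.
  by rewrite (linearZ_LR g) /= xE; apply: esym; apply: (linearZ_LR f).
congr (f _); apply: fval_inj; rewrite /fval raddf_sum /= -/(fval u).
rewrite -[RHS](fixmodP u) [in RHS](row_sum_delta (fval u)) mulmx_suml.
by apply: eq_bigr => i _; rewrite -scalemxAl.
Qed.

(** All degrees live in one free module: [e i] cuts out degree [i] and the single matrix [D] induces
    every differential. Complexes thus become matrix identities, and dependently typed maps appear
    only in the conclusion. *)
Lemma matrix_resolution (M : lmodType R) (e : nat -> 'M[R]_N) (D : 'M[R]_N)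
    (eps : {linear 'rV[R]_N -> M}) :
  (forall i, e i *m e i = e i) ->
  (forall i, e i.+1 *m D *m e i = e i.+1 *m D) ->
  (forall i, e i.+2 *m D *m D = 0) ->
  (forall x, exists v : 'rV[R]_N, eps (v *m e 0%N) = x) ->
  (forall v : 'rV[R]_N, eps (v *m e 1%N *m D) = 0) ->
  (forall v : 'rV[R]_N, v *m e 0%N = v -> eps v = 0 ->
     exists w : 'rV[R]_N, w *m e 1%N *m D = v) ->
  (forall i (v : 'rV[R]_N), v *m e i.+1 = v -> v *m D = 0 ->
     exists w : 'rV[R]_N, w *m e i.+2 *m D = v) ->
  exists (d : forall i, {linear fixmod (e i.+1) -> fixmod (e i)})
         (eps' : {linear fixmod (e 0%N) -> M}),
  [/\ (forall i, projective (fixmod (e i))) /\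
      (forall i p, fval (d i p) = fval p *m D),
      forall m, exists p, eps' p = m,
      forall p, eps' p = 0 <-> exists q, d 0 q = p &
      forall i p, d i p = 0 <-> exists q, d i.+1 q = p].
Proof.
move=> ee eD eDD epssurj epsD ex0 ex.
have eDe i (v : 'rV[R]_N) : v *m e i.+1 *m D *m e i = v *m e i.+1 *m D.
  by rewrite -!mulmxA [e _ *m _]mulmxA eD.
have eDD' i (v : 'rV[R]_N) : v *m e i.+2 *m D *m D = 0.
  by rewrite -!mulmxA [e _ *m _]mulmxA eDD mulmx0.
have inD i (p : fixmod (e i.+1)) : fval p *m D *m e i = fval p *m D.
  by rewrite -(fixmodP p) eDe.
have dP i : {d : {linear fixmod (e i.+1) -> fixmod (e i)} |
    forall p, fval (d p) = fval p *m D}.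
  apply: cid; have [|d dE] := @linear_of R (fixmod (e i.+1)) (fixmod (e i))
    (fun p => fixmod_sub (inD i p)).
    move=> a u v; apply: fval_inj.
    have -> : fval (fixmod_sub (inD i (a *: u + v))) =
      a *: (fval u *m D) + fval v *m D by rewrite scalemxAl -mulmxDl.
    by [].
  by exists d => p; rewrite dE.
exists (fun i => sval (dP i)), (eps \o fixmod_val _)%FUN.
have dE i p : fval (sval (dP i) p) = fval p *m D by apply: (svalP (dP i)).
have eep i (v : 'rV[R]_N) : v *m e i *m e i = v *m e i by rewrite -mulmxA ee.
split.
- by split => // i; apply: fixmod_projective.
- by move=> m; have [v <-] := epssurj m; exists (fixmod_sub (eep 0%N v)).
- move=> p; split=> [/(ex0 _ (fixmodP p))[w wE]|[q <-]].
    by exists (fixmod_sub (eep _ w)); apply: fval_inj; apply: etrans (dE _ _) _.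
  by rewrite -[LHS]/(eps (fval (sval (dP 0%N) q))) dE -(fixmodP q) epsD.
- move=> i p; split=> [pD|[q <-]].
    have [|w wE] := ex i (fval p) (fixmodP p);
      first by rewrite -dE pD /fval raddf0.
    by exists (fixmod_sub (eep _ w)); apply: fval_inj; apply: etrans (dE _ _) _.
  by apply: fval_inj; rewrite !dE -(fixmodP q) eDD' /fval raddf0.
Qed.

End MatrixResolution.

(** * Matrices indexed by a finite type *)

Section IndexedMatrix.
Variable I : finType.

Definition imx (R : Type) (f : I -> I -> R) : 'M[R]_#|I| :=
  \matrix_(i, j) f (enum_val i) (enum_val j).

Definition ent (R : Type) (X : 'M[R]_#|I|) (i j : I) : R :=
  X (enum_rank i) (enum_rank j).

Definition vent (R : Type) (v : 'rV[R]_#|I|) (i : I) : R := v 0 (enum_rank i).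

Lemma ent_imx (R : Type) (f : I -> I -> R) i j : ent (imx f) i j = f i j.
Proof. by rewrite /ent mxE !enum_rankK. Qed.

Lemma ent_inj (R : Type) (X Y : 'M[R]_#|I|) :
  (forall i j, ent X i j = ent Y i j) -> X = Y.
Proof.
by move=> XY; apply/matrixP => i j; have := XY (enum_val i) (enum_val j);
  rewrite /ent !enum_valK.
Qed.

Lemma vent_inj (R : Type) (u v : 'rV[R]_#|I|) : vent u =1 vent v -> u = v.
Proof.
by move=> uv; apply/rowP => j; have := uv (enum_val j); rewrite /vent enum_valK.
Qed.

Section Ring.
Variable R : nzRingType.
Implicit Types (X Y : 'M[R]_#|I|) (v : 'rV[R]_#|I|).

Lemma ent0 i j : ent (0 : 'M[R]_#|I|) i j = 0.
Proof. by rewrite /ent mxE. Qed.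

Lemma entD X Y i j : ent (X + Y) i j = ent X i j + ent Y i j.
Proof. by rewrite /ent mxE. Qed.

Lemma entN X i j : ent (- X) i j = - ent X i j.
Proof. by rewrite /ent mxE. Qed.

Lemma entM X Y i j : ent (X *m Y) i j = \sum_l ent X i l * ent Y l j.
Proof.
rewrite /ent mxE (reindex (@enum_rank I)) //.
by apply: onW_bij; apply: enum_rank_bij.
Qed.

Lemma ventM v X j : vent (v *m X) j = \sum_l vent v l * ent X l j.
Proof.
rewrite /vent mxE (reindex (@enum_rank I)) //.
by apply: onW_bij; apply: enum_rank_bij.
Qed.

Lemma entM_neq0 X Y i j : ent (X *m Y) i j != 0 ->
  exists2 l, ent X i l != 0 & ent Y l j != 0.
Proof.
move=> nz; have [l|none] :=
  pickP [pred l | (ent X i l != 0) && (ent Y l j != 0)].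
  by case/andP; exists l.
case/eqP: nz; rewrite entM big1 // => l _; have := none l => /=.
have [->|_] := eqVneq (ent X i l) 0; first by rewrite mul0r.
by move/negbFE/eqP ->; rewrite mulr0.
Qed.

Definition pmx (P : pred I) : 'M[R]_#|I| :=
  imx (fun i j => ((i == j) && P i)%:R).

Lemma ent_pmx P i j : ent (pmx P) i j = ((i == j) && P i)%:R.
Proof. exact: ent_imx. Qed.

Lemma entMpl P X i j : ent (pmx P *m X) i j = if P i then ent X i j else 0.
Proof.
rewrite entM (bigD1 i) //= big1 ?addr0 => [|l /negPf nil].
  by rewrite ent_pmx eqxx; case: (P i); rewrite ?mul1r ?mul0r.
by rewrite ent_pmx eq_sym nil mul0r.
Qed.

Lemma entMpr P X i j : ent (X *m pmx P) i j = if P j then ent X i j else 0.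
Proof.
rewrite entM (bigD1 j) //= big1 ?addr0 => [|l /negPf nil].
  by rewrite ent_pmx eqxx; case: (P j); rewrite ?mulr1 ?mulr0.
by rewrite ent_pmx nil mulr0.
Qed.

Lemma ventMp P v j : vent (v *m pmx P) j = if P j then vent v j else 0.
Proof.
rewrite ventM (bigD1 j) //= big1 ?addr0 => [|l /negPf nil].
  by rewrite ent_pmx eqxx; case: (P j); rewrite ?mulr1 ?mulr0.
by rewrite ent_pmx nil mulr0.
Qed.

Lemma pmx_idem P : pmx P *m pmx P = pmx P.
Proof.
apply: ent_inj => i j; rewrite entMpl !ent_pmx.
by case: (P i); rewrite ?andbF.
Qed.

End Ring.

Lemma ent_map (R S : Type) (f : R -> S) (X : 'M[R]_#|I|) i j :
  ent (map_mx f X) i j = f (ent X i j).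
Proof. by rewrite /ent mxE. Qed.

Lemma map_pmx (R S : nzRingType) (f : {rmorphism R -> S}) (P : pred I) :
  map_mx f (pmx R P) = pmx S P.
Proof. by apply: ent_inj => i j; rewrite ent_map !ent_pmx rmorph_nat. Qed.

End IndexedMatrix.

(** * Truncation, homotopies and contractions in matrix form *)

Lemma truncated_resolution (R : comNzRingType) (N : nat) (M : lmodType R)
    (e : nat -> 'M[R]_N) (D T : 'M[R]_N) (eps : {linear 'rV[R]_N -> M}) n :
  (forall i, e i *m e i = e i) ->
  (forall i, e i.+1 *m D *m e i = e i.+1 *m D) ->
  D *m D = 0 ->
  (forall x, exists v : 'rV[R]_N, eps (v *m e 0%N) = x) ->
  (forall v : 'rV[R]_N, eps (v *m e 1%N *m D) = 0) ->
  (forall v : 'rV[R]_N, v *m e 0%N = v -> eps v = 0 ->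
     exists w : 'rV[R]_N, w *m e 1%N *m D = v) ->
  (forall i (v : 'rV[R]_N), v *m e i.+1 = v -> v *m D = 0 ->
     exists w : 'rV[R]_N, w *m e i.+2 *m D = v) ->
  e n *m T *m e n.+1 = e n *m T ->
  e n.+1 *m D *m T *m D = e n.+1 *m D ->
  has_projective_resolution M n.
Proof.
move=> ee eDe DD epssurj epsD ex0 ex gT projD.
(* The boundaries in degree [n] form a direct summand, with projection [T D];
   truncate there, replacing [e n] by the complementary projection. *)
pose q := e n - e n *m T *m D.
pose E i := if (i < n)%N then e i else if i == n then q else 0.
have Elt i : (i < n)%N -> E i = e i by rewrite /E => ->.
have En : E n = q by rewrite /E ltnn eqxx.
have Egt i : (n < i)%N -> E i = 0.
  by rewrite /E => lt; rewrite ltnNge (ltnW lt) gtn_eqF.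
have DDr X : X *m D *m D = 0 :> 'M[R]_N by rewrite -mulmxA DD mulmx0.
have eT : e n *m T *m D *m e n = e n *m T *m D.
  by rewrite -gT -!mulmxA [e n.+1 *m (D *m e n)]mulmxA eDe.
have projD' : e n.+1 *m (D *m (T *m D)) = e n.+1 *m D.
  by rewrite !mulmxA projD.
have TDTD : e n *m T *m D *m T *m D = e n *m T *m D.
  by rewrite -gT -!mulmxA projD'.
have qe : q *m e n = q by rewrite mulmxBl ee eT.
have qq : q *m q = q.
  by rewrite {2}/q mulmxBr qe !mulmxA qe mulmxBl mulmxBl TDTD subrr subr0.
have qD : q *m D = e n *m D by rewrite mulmxBl DDr subr0.
have Ee i : E i *m e i = E i.
  have [lt|gt|->] := ltngtP i n; first by rewrite Elt.
    by rewrite Egt // mul0mx.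
  by rewrite En.
have EE i : E i *m E i = E i.
  have [lt|gt|->] := ltngtP i n; first by rewrite Elt.
    by rewrite Egt // mul0mx.
  by rewrite En.
have ED i : E i *m D = if (i <= n)%N then e i *m D else 0.
  have [lt|gt|->] := ltngtP i n; first by rewrite Elt.
    by rewrite Egt // mul0mx.
  by rewrite En.
(* Exactness passes from [e] to [E]: below [n] nothing changes, above [n] the vector is zero, and at
   [n] a boundary fixed by [q] is zero because [q] kills the boundaries. *)
have transfer i (v : 'rV[R]_N) : v *m E i = v ->
    (exists w : 'rV[R]_N, w *m e i.+1 *m D = v) ->
    exists w : 'rV[R]_N, w *m E i.+1 *m D = v.
  move=> vE [w wD]; have [ltin|gtin|ein] := ltngtP i n.
  - by exists w; rewrite -mulmxA ED ltin mulmxA.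
  - by exists 0; rewrite !mul0mx -vE Egt ?mulmx0.
  exists 0; rewrite !mul0mx -vE ein En mulmxBr !mulmxA.
  rewrite ein in wD; have ve : v *m e n =
    v by rewrite -wD -!mulmxA [e _ *m (D *m _)]mulmxA eDe.
  by rewrite ve -wD -!mulmxA projD' subrr.
have vEe i (v : 'rV[R]_N) : v *m E i = v -> v *m e i = v.
  by move=> <-; rewrite -mulmxA Ee.
have [||||||d [eps' [[pr _] su e0 ex']]] :=
    @matrix_resolution R N M E D eps EE.
- move=> i; rewrite ED; case: ifPn => [lein|]; last by rewrite mul0mx.
  by rewrite Elt // eDe.
- by move=> i; apply: DDr.
- move=> x; have [v <-] := epssurj x.
  have [n0|n0] := posnP n; last by exists v; rewrite Elt.
  (* For [n = 0] the new projection differs from [e 0] by a boundary, which [eps] kills. *)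
  exists v; have -> : E 0%N = q by rewrite -En n0.
  rewrite mulmxBr raddfB /= -gT !mulmxA.
  have -> : e n.+1 = e 1%N by rewrite n0.
  by rewrite epsD subr0 n0.
- by move=> v; rewrite -(Ee 1%N) !mulmxA epsD.
- by move=> v vE v0; apply: transfer (vE) _; apply: ex0 v0; apply: vEe vE.
- by move=> i v vE vD; apply: transfer (vE) _; apply: ex vD; apply: vEe vE.
exists (fun i => fixmod (E i)), d, eps'; split=> // i lt p.
have Ep : fval p *m E i = fval p := fixmodP p.
by apply: fval_inj; rewrite -Ep [X in _ *m X]Egt // mulmx0 /fval raddf0.
Qed.

(** [T] is a homotopy from [I] to [defect]. Since [I - defect^j] is [I - defect] times a geometric
    sum commuting with [D], multiplying [T] by that sum gives a homotopy from [I] to [defect^j]. *)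
Lemma homotopy_iterate (R : nzRingType) (N : nat) (I D T : 'M[R]_N) j :
  let defect := I - (D *m T + T *m D) in
  I *m I = I -> I *m D = D -> D *m I = D -> I *m T = T -> D *m D = 0 ->
  exists T', D *m T' + T' *m D = I - iter j (mulmx defect) I.
Proof.
move=> defect II ID DI IT DD.
have dD : defect *m D = D *m defect.
  rewrite mulmxBl mulmxBr ID DI mulmxDl mulmxDr !mulmxA DD mul0mx add0r.
  by rewrite -[T *m D *m D]mulmxA DD mulmx0 addr0.
have Id : I *m defect = defect.
  by rewrite mulmxBr mulmxDr !mulmxA II ID IT.
pose pow j := iter j (mulmx defect) I.
have powS i : pow i.+1 = defect *m pow i by [].
have Ipow i : I *m pow i = pow i.
  by case: i => [|i] //; rewrite powS mulmxA Id.
have powD i : pow i *m D = D *m pow i.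
  elim: i => [|i IHi]; first by rewrite /= ID DI.
  by rewrite powS -mulmxA IHi !mulmxA dD.
(* [X] is the sum of the powers of [defect] with exponent below [j]. *)
suff [X [XD XE]] : exists X, X *m D = D *m X /\ (I - defect) *m X = I - pow j.
  exists (T *m X); rewrite mulmxA -[T *m X *m D]mulmxA XD [T *m (D *m X)]mulmxA.
  by rewrite -mulmxDl -XE /defect subKr.
elim: j => [|j [X [XD XE]]].
  by exists 0; rewrite mul0mx !mulmx0 subrr.
exists (X + pow j); rewrite mulmxDl mulmxDr XD powD; split=> //.
rewrite mulmxDr XE mulmxBl Ipow -powS.
by rewrite addrA addrNK.
Qed.

(** Precomposing with the projection [e] extends the map to the whole free module, where it has a
    matrix. *)
Lemma fixmod_map_matrix (R : comNzRingType) (N : nat) (e e' : 'M[R]_N)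
    (f : {linear fixmod e -> fixmod e'}) : e *m e = e ->
  exists S : 'M[R]_N, forall p, fval p *m S = fval (f p).
Proof.
move=> ee; have inF (v : 'rV[R]_N) : v *m e *m e = v *m e by rewrite -mulmxA ee.
have [|h hE] := @linear_of R 'rV[R]_N 'rV[R]_N
    (fun v => fval (f (fixmod_sub (inF v)))).
  move=> c u v; have -> : fixmod_sub (inF (c *: u + v)) =
      c *: fixmod_sub (inF u) + fixmod_sub (inF v).
    apply: fval_inj; rewrite fval_linear -[LHS]/((c *: u + v) *m e).
    by rewrite mulmxDl -scalemxAl.
  by rewrite (linearP f) fval_linear.
exists (lin1_mx h) => p; rewrite mul_rV_lin1 hE; congr (fval (f _)).
by apply: fval_inj; apply: fixmodP.
Qed.

(** This puts [resolution_contraction] into the form of a matrix identity, to which a ring morphism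
    can then be applied entrywise. *)
Lemma matrix_contraction (R : comNzRingType) (N : nat) (M : lmodType R)
    (e : nat -> 'M[R]_N) (D : 'M[R]_N) (eps : {linear 'rV[R]_N -> M}) m n :
  (forall i, e i *m e i = e i) ->
  (forall i, e i.+1 *m D *m e i = e i.+1 *m D) ->
  (forall i, e i.+2 *m D *m D = 0) ->
  (forall x, exists v : 'rV[R]_N, eps (v *m e 0%N) = x) ->
  (forall v : 'rV[R]_N, eps (v *m e 1%N *m D) = 0) ->
  (forall v : 'rV[R]_N, v *m e 0%N = v -> eps v = 0 ->
     exists w : 'rV[R]_N, w *m e 1%N *m D = v) ->
  (forall i (v : 'rV[R]_N), v *m e i.+1 = v -> v *m D = 0 ->
     exists w : 'rV[R]_N, w *m e i.+2 *m D = v) ->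
  has_projective_resolution M m -> (m <= n)%N ->
  exists S S' : 'M[R]_N,
    e n.+1 = e n.+1 *m S *m D + e n.+1 *m D *m S'.
Proof.
move=> ee eDe eDD epssurj epsD ex0 ex res lemn.
have [d [eps' [[pr dE] su e0 ex']]] :=
  matrix_resolution ee eDe eDD epssurj epsD ex0 ex.
have [s sE] := resolution_contraction res pr su e0 ex'.
have [S SE] := fixmod_map_matrix (s n.+1) (ee n.+1).
have [S' S'E] := fixmod_map_matrix (s n) (ee n).
exists S, S'; apply/row_matrixP => i; rewrite !rowE.
move: (delta_mx 0 i) => v; rewrite mulmxDr !mulmxA.
have inF : v *m e n.+1 *m e n.+1 = v *m e n.+1 by rewrite -mulmxA ee.
have := congr1 (@fval R N (e n.+1)) (sE n lemn (fixmod_sub inF)).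
by rewrite fvalD dE -SE -S'E dE.
Qed.

(** * Simplicial boundary matrices *)

Section Boundary.
Variables (A : finType) (r : A -> nat).
Hypothesis r_inj : injective r.

Definition below (s : {set A}) (a : A) : nat := #|[set b in s | (r b < r a)%N]|.

(* The sign depends on the order [r] of the labels. It stays a parameter, since
   splitting a complex as a tensor product requires the labels of the first
   factor to precede those of the second. *)
Definition sgn (R : nzRingType) (s : {set A}) (a : A) : R := (-1) ^+ below s a.

Lemma belowD1 (s : {set A}) a b : a \in s ->
  below s b = ((r a < r b) + below (s :\ a) b)%N.
Proof.
move=> sa; rewrite /below (cardsD1 a) inE sa /=; congr (_ + _)%N.
by apply: eq_card => x; rewrite !inE andbA.
Qed.

(** Of the counts [below s a] and [below s b], exactly one drops when the other label is removed:
    that of the larger label. *)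
Lemma sgn_anti (R : comNzRingType) (s : {set A}) a b : a \in s ->
  b \in s -> a != b ->
  sgn R s a * sgn R (s :\ a) b = - (sgn R s b * sgn R (s :\ b) a).
Proof.
move=> sa sb ab; rewrite /sgn (belowD1 a sb) (belowD1 b sa) !exprD.
have [ltab|ltba|/r_inj eab] := ltngtP (r a) (r b);
  last by rewrite eab eqxx in ab.
  by rewrite expr1 expr0; ring.
by rewrite expr1 expr0; ring.
Qed.

Lemma sgn_sqr (R : comNzRingType) s a : sgn R s a * sgn R s a = 1.
Proof. by rewrite /sgn -expr2 sqrr_sign. Qed.

Lemma map_sgn (R S : nzRingType) (f : {rmorphism R -> S}) s a :
  f (sgn R s a) = sgn S s a.
Proof. by rewrite /sgn rmorphXn rmorphN1. Qed.

Section Weighted.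
Variables (R : comNzRingType) (c : {set A} -> {set A} -> R).

(** The weighted simplicial boundary, acting on row vectors. Monomial weights give the Taylor
    complex, weights in [{0, 1}] its reduction to [k]. *)
Definition bd : 'M[R]_#|{set A}| :=
  imx (fun s t : {set A} => \sum_(a in s | t == s :\ a) sgn R s a * c s t).

Lemma bd_neq0 (s t : {set A}) : ent bd s t != 0 ->
  exists2 a, a \in s & t = s :\ a.
Proof.
rewrite ent_imx => nz.
have [a /andP[sa /eqP tE]|none] := pickP [pred a in s | t == s :\ a].
  by exists a.
by rewrite big_pred0 ?eqxx in nz.
Qed.

Lemma bd_row (s : {set A}) (u : {set A} -> R) :
  \sum_t ent bd s t * u t =
  \sum_(a in s) sgn R s a * c s (s :\ a) * u (s :\ a).
Proof.
under eq_bigr do rewrite ent_imx big_mkcondr mulr_suml.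
rewrite exchange_big; apply: eq_bigr => a sa /=.
rewrite (bigD1 (s :\ a)) //= eqxx big1 ?addr0 // => t /negPf ->.
by rewrite mul0r.
Qed.

Lemma bd_col (t : {set A}) (v : {set A} -> R) :
  \sum_s v s * ent bd s t =
  \sum_(a | a \notin t) v (a |: t) * (sgn R (a |: t) a * c (a |: t) t).
Proof.
under eq_bigr do rewrite ent_imx mulr_sumr.
rewrite (exchange_big_dep predT) //= [RHS]big_mkcond; apply: eq_bigr => a _.
case: ifPn => [ta|]; last first.
  rewrite negbK => ta; apply: big_pred0 => s; apply/negbTE/negP.
  by case/andP=> _ /eqP tE; rewrite tE !inE eqxx in ta.
apply: big_pred1 => s /=; apply/andP/eqP=> [[sa /eqP->]|->].
  by rewrite setD1K.
by rewrite setU1K // setU11.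
Qed.

Hypothesis cM : forall (s : {set A}) a b, a \in s -> b \in s -> a != b ->
  c s (s :\ a) * c (s :\ a) (s :\ a :\ b) = c s (s :\ a :\ b).

(** By [cM] the weight of a double removal does not depend on the order, while the sign does; the
    two orders cancel. *)
Lemma bd_bd : bd *m bd = 0.
Proof.
apply: ent_inj => s t; rewrite entM bd_row ent0.
pose F a b := (t == s :\ a :\ b)%:R * (sgn R s a * sgn R (s :\ a) b * c s t).
transitivity (\sum_(a in s) \sum_(b in s | a != b) F a b).
  apply: eq_bigr => a sa; rewrite ent_imx mulr_sumr.
  rewrite big_mkcondr /= [RHS]big_mkcond /= [LHS]big_mkcond /=.
  apply: eq_bigr => b _; rewrite !inE eq_sym andbC.
  have [sb|] := boolP (b \in s) => //=; have [//|ab] := eqVneq a b => /=.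
  rewrite /F; have [->|] := eqVneq t; last by rewrite mul0r.
  rewrite -(cM sa sb ab) mul1r; ring.
(* Split the ordered pairs by [r a < r b] and swap the coordinates in the second half, so that the
   halves cancel term by term. *)
rewrite pair_big_dep /= (bigID (fun p => r p.1 < r p.2)%N) /=.
rewrite [X in _ + X](reindex_inj (h := fun p => (p.2, p.1))) /=; last first.
  by move=> [? ?] [? ?] [-> ->].
rewrite [X in _ + X](eq_bigl [pred p | [&& p.1 \in s, p.2 \in s & p.1 != p.2]
  && (r p.1 < r p.2)%N]) /=; last first.
  move=> [a b] /=; rewrite [b == a]eq_sym -leqNgt leq_eqVlt.
  rewrite (inj_eq r_inj); case: (a \in s); case: (b \in s) => //=.
  by case: eqVneq.
rewrite -big_split big1 //= => -[a b] /= /andP[/and3P[sa sb ab] _].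
rewrite /F setDDl setUC -setDDl sgn_anti //.
by rewrite mulNr mulrN addNr.
Qed.

End Weighted.
End Boundary.

(** * The scalar complex and its homology *)

Section ScalarComplex.
Variables (V : finType) (k : fieldType) (r : {set V} -> nat).
Hypothesis r_inj : injective r.

Local Notation mat := 'M[k]_#|{set {set V}}|.
Implicit Types (s t u : {set {set V}}) (B : {set {set V}}) (X Y : mat).

(** The Taylor weight, a quotient of two monomials, reduced modulo the variables: it survives only
    if both covers agree. *)
Definition cover_weight s t : k := (cover s == cover t)%:R.

Lemma coverS s t : s \subset t -> cover s \subset cover t.
Proof.
move=> st; apply/subsetP => x /bigcupP[a sa ax]; apply/bigcupP; exists a => //.
exact: (subsetP st).
Qed.

(** Covers only shrink along removals, so equal covers at both ends force equality in the middle. *)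
Lemma cover_weightM s (a b : {set V}) : a \in s -> b \in s -> a != b ->
  cover_weight s (s :\ a) * cover_weight (s :\ a) (s :\ a :\ b) =
  cover_weight s (s :\ a :\ b).
Proof.
move=> _ _ _; rewrite /cover_weight.
have c1 := coverS (subsetDl s [set a]).
have c2 := coverS (subsetDl (s :\ a) [set b]).
case: (eqVneq (cover s) (cover (s :\ a))) => [->|ne]; first by rewrite mul1r.
case: (eqVneq (cover s)) => [e|]; last by rewrite mul0r.
by case/negP: ne; rewrite eqEsubset c1 e c2.
Qed.

Definition scalar_bd : mat := bd r cover_weight.

Lemma scalar_bd_bd : scalar_bd *m scalar_bd = 0.
Proof. exact: bd_bd cover_weightM. Qed.

Definition onB B : mat := pmx k [pred s : {set {set V}} | s \subset B].

(* Locked, lest matching on [_ *m _] unfold it. *)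
Fact bdB_key : unit. Proof. by []. Qed.
Definition bdB B : mat := locked_with bdB_key (onB B *m scalar_bd).

Lemma bdBE B : bdB B = onB B *m scalar_bd.
Proof. by rewrite /bdB locked_withE. Qed.

Definition deg s : nat := #|s|.

(** The pair [i], [j] encodes the degree shift [j - i] without subtraction: [1 0] for differentials,
    [0 1] for homotopies, [0 0] for projections. *)
Definition shift_rel B i j s t : Prop :=
  [/\ s \subset B, t \subset B, deg t + i = deg s + j & cover s = cover t]%N.

Definition hom B i j X := forall s t, ent X s t != 0 -> shift_rel B i j s t.

Lemma ent_onB B s t : ent (onB B) s t = ((s == t) && (s \subset B))%:R.
Proof. by rewrite ent_pmx. Qed.

Lemma homM B i j i' j' X Y : hom B i j X -> hom B i' j' Y ->
  hom B (i + i') (j + j') (X *m Y).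
Proof.
move=> hX hY s t /entM_neq0[u /hX[sB _ c1 e1] /hY[_ tB c2 e2]].
by split=> //; [lia | rewrite e1].
Qed.

Lemma homD B i j X Y : hom B i j X -> hom B i j Y -> hom B i j (X + Y).
Proof.
move=> hX hY s t; rewrite entD => nz.
have [X0|/hX//] := eqVneq (ent X s t) 0.
by apply: hY; rewrite X0 add0r in nz.
Qed.

Lemma homN B i j X : hom B i j X -> hom B i j (- X).
Proof. by move=> hX s t; rewrite entN oppr_eq0; apply: hX. Qed.

Lemma hom_shift B i j i' j' X : (i + j' = i' + j)%N -> hom B i j X ->
  hom B i' j' X.
Proof. by move=> e hX s t /hX[? ? ? ?]; split=> //; lia. Qed.

Lemma hom_onB B : hom B 0 0 (onB B).
Proof.
move=> s t; rewrite ent_onB; have [<-|_] := eqVneq s t; last by rewrite eqxx.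
by have [sB|_] := boolP (s \subset B); rewrite ?eqxx.
Qed.

Lemma ent_bdB B s t :
  ent (bdB B) s t = if s \subset B then ent scalar_bd s t else 0.
Proof. by rewrite bdBE entMpl. Qed.

Lemma hom_bdB B : hom B 1 0 (bdB B).
Proof.
move=> s t; rewrite ent_bdB; case: ifP => [sB nz|]; last by rewrite eqxx.
have [a sa tE] := bd_neq0 nz; split=> //.
- by rewrite tE (subset_trans (subsetDl _ _)).
- by rewrite /deg (cardsD1 a s) sa tE addn0 addnC.
apply: contraNeq nz => ne; rewrite /scalar_bd /bd ent_imx big1 // => b _.
by rewrite /cover_weight (negPf ne) mulr0.
Qed.
Lemma hom_onBl B i j X : hom B i j X -> onB B *m X = X.
Proof.
move=> hX; apply: ent_inj => s t; rewrite entMpl /=.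
case: ifPn => // sB; apply/esym/eqP; apply: contraNT sB => nz.
by have [] := hX _ _ nz.
Qed.

Lemma hom_onBr B i j X : hom B i j X -> X *m onB B = X.
Proof.
move=> hX; apply: ent_inj => s t; rewrite entMpr /=.
case: ifPn => // tB; apply/esym/eqP; apply: contraNT tB => nz.
by have [] := hX _ _ nz.
Qed.

Lemma bdB_bdB B : bdB B *m bdB B = 0.
Proof.
rewrite {2}bdBE mulmxA (hom_onBr (@hom_bdB B)) bdBE -mulmxA scalar_bd_bd.
exact: mulmx0.
Qed.

(* [T] is a contracting homotopy up to the projection [p] onto a copy of the
   homology of the complex [bdB B]; [n] is the top degree of that homology. *)
Definition homology_splitting B (T p : mat) :=
  [/\ hom B 0 1 T, hom B 0 0 p, bdB B *m T + T *m bdB B = onB B - p,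
      p *m bdB B = 0 /\ bdB B *m p = 0 & p *m p = p].

Definition homology_top B (n : nat) := exists T p : mat,
  [/\ homology_splitting B T p,
      exists s t, deg s = n /\ ent p s t != 0 &
      forall s t, ent p s t != 0 -> (deg s <= n)%N].

(** Over a field the differential has a generalized inverse; made homogeneous and normalised to
    square zero, it is a homotopy whose defect [p] is idempotent. *)
Lemma splitting_exists B : exists T p, homology_splitting B T p.
Proof.
have [D DE] : exists D, D = bdB B by exists (bdB B).
rewrite /homology_splitting -DE.
have hD : hom B 1 0 D by rewrite DE; apply: hom_bdB.
have DD : D *m D = 0 by rewrite DE bdB_bdB.
have [S0 DS0D] : exists S0, D *m S0 *m D = D.
  by exists (pinvmx D); apply: mulmxKpV.
(* Keep only the entries of [S0] that raise the degree by one and preserve the cover. As [D] is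
   homogeneous, the other entries do not affect the product on the entries where [D] can be
   nonzero. *)
pose ok s t := [&& s \subset B, t \subset B,
  deg t == (deg s).+1 & cover s == cover t].
have [S1 S1E] : exists S1 : mat,
    S1 = imx (fun s t => if ok s t then ent S0 s t else 0) by eexists.
have hS1 : hom B 0 1 S1.
  move=> s t; rewrite S1E ent_imx;
    case: ifP => [/and4P[sB tB /eqP c /eqP e] _|].
    by split=> //; rewrite c; lia.
  by rewrite eqxx.
have DS1D : D *m S1 *m D = D.
  apply: ent_inj => s t.
  have [[sB tB cst est]|no] := pselect (shift_rel B 1 0 s t).
    rewrite -[in RHS]DS0D -!mulmxA entM [RHS]entM.
    apply: eq_bigr => u _; have [->|/hD[_ uB cu eu]] := eqVneq (ent D s u) 0.
      by rewrite !mul0r.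
    rewrite !entM; congr (_ * _); apply: eq_bigr => v _.
    have [->|/hD[vB _ cv ev]] := eqVneq (ent D v t) 0; first by rewrite !mulr0.
    congr (_ * _); rewrite S1E ent_imx /ok uB vB -eu est -ev eqxx /=.
    by rewrite ifT // andbT; apply/eqP; lia.
  have D0 i j X : i = j.+1 -> hom B i j X -> ent X s t = 0.
    move=> ij hX; apply/eqP; apply: contra_notT no => /hX[sB tB c e].
    by split=> //; lia.
  rewrite (D0 _ _ _ _ hD) //.
  by rewrite (D0 _ _ _ _ (homM (homM hD hS1) hD)).
(* [S1 D S1] is a generalized inverse in both directions; the second identity then makes the square
   of [T1 - T1 T1 D] vanish. *)
have [T1 [hT1 DT1D T1DT1]] : exists T1,
    [/\ hom B 0 1 T1, D *m T1 *m D = D & T1 *m D *m T1 = T1].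
  exists (S1 *m D *m S1); split; rewrite ?mulmxA ?DS1D //.
    by apply: hom_shift (homM (homM hS1 hD) hS1).
  by rewrite -[S1 *m D *m S1 *m D]mulmxA -[S1 *m D *m (S1 *m D)]mulmxA
    [D *m (S1 *m D)]mulmxA DS1D -[S1 *m D *m S1 *m D]mulmxA
    -[S1 *m D *m (S1 *m D)]mulmxA [D *m (S1 *m D)]mulmxA DS1D.
have [T [hT DTD TT]] : exists T,
    [/\ hom B 0 1 T, D *m T *m D = D & T *m T = 0].
  exists (T1 - T1 *m T1 *m D); split.
  - apply: homD => //; apply: homN.
    exact: hom_shift (homM (homM hT1 hT1) hD).
  - by rewrite mulmxBr mulmxBl DT1D -!mulmxA DD !mulmx0 subr0.
  rewrite mulmxBr !mulmxBl !mulmxA.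
  have -> : T1 *m T1 *m D *m T1 = T1 *m T1.
    by rewrite -!mulmxA [T1 *m (D *m _)]mulmxA T1DT1.
  by rewrite !subrr.
have [p pE] : exists p, p = onB B - D *m T - T *m D by eexists.
have hp : hom B 0 0 p.
  rewrite pE; apply: homD; first apply: homD; first exact: hom_onB.
    by apply: homN; apply: hom_shift (homM hD hT).
  by apply: homN; apply: hom_shift (homM hT hD).
have pD : p *m D = 0.
  rewrite pE !mulmxBl (hom_onBl hD) DTD subrr sub0r -mulmxA DD mulmx0.
  exact: oppr0.
have Dp : D *m p = 0.
  by rewrite pE !mulmxBr (hom_onBr hD) !mulmxA DD mul0mx DTD subr0 subrr.
exists T, p; split=> //.
  by rewrite pE opprD opprK opprD opprK !addrA subrr add0r.
rewrite {2}pE !mulmxBr (hom_onBr hp) !mulmxA pD mul0mx subr0.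
have -> : p *m T *m D = 0; last exact: subr0.
rewrite pE !mulmxBl (hom_onBl hT) -[D *m T *m T]mulmxA TT mulmx0 mul0mx subr0.
by rewrite -[T *m D *m T *m D]mulmxA -[T *m D *m (T *m D)]mulmxA [D *m (T *m
  D)]mulmxA DTD subrr.
Qed.

(** The empty face always survives in the homology: a singleton face with empty cover would have to
    be [[set set0]]. Hence the degrees supporting [p] form a nonempty bounded set. *)
Lemma homology_top_exists B : set0 \notin B -> exists n, homology_top B n.
Proof.
move=> B0; have [T [p sp]] := splitting_exists B; have [hT hp E _ _] := sp.
pose P n := [exists s, exists t, (deg s == n) && (ent p s t != 0)].
have p00 : ent p set0 set0 != 0.
  have hDT := homM (@hom_bdB B) hT.
  have -> : p = onB B - (bdB B *m T + T *m bdB B) by rewrite E opprB addrC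
    subrK.
  rewrite entD entN entD ent_onB eqxx sub0set.
  have -> : ent (bdB B *m T) set0 set0 = 0.
    apply/eqP; apply: contraT => /entM_neq0[u /(@hom_bdB B)[_ _]].
    by rewrite /deg cards0; lia.
  have -> : ent (T *m bdB B) set0 set0 = 0.
    apply/eqP; apply: contraT => /entM_neq0[u /hT[_ uB]].
    rewrite /deg cards0 addn0 => /eqP/cards1P[a ua] c0.
    have aB : a \in B by rewrite (subsetP uB) // ua inE.
    have a0 : a = set0.
      apply/eqP; rewrite -subset0; have <- : cover set0 = set0 :> {set V}.
        by rewrite /cover big_set0.
      by rewrite c0 ua cover1.
    by rewrite a0 (negPf B0) in aB.
  by rewrite addr0 subr0 oner_eq0.
have exP : exists n, P n.
  by exists 0%N; apply/existsP; exists set0; apply/existsP; exists set0;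
    rewrite /deg cards0 eqxx.
have bP n : P n -> (n <= #|{: {set V}}|)%N.
  by move=> /existsP[s /existsP[t /andP[/eqP<- _]]]; apply: max_card.
case: (ex_maxnP exP bP) => n /existsP[s /existsP[t /andP[/eqP cs nz]]] nmax.
exists n, T, p; split=> //; first by exists s, t.
move=> s' t' nz'; apply: nmax; apply/existsP; exists s'; apply/existsP.
by exists t'; rewrite eqxx.
Qed.

(** The only possible boundary goes from a singleton to the empty face and changes the cover, so the
    differential is zero and [onB B] is itself the projection. *)
Lemma homology_top_small B : set0 \notin B -> (#|B| <= 1)%N ->
  homology_top B #|B|.
Proof.
move=> B0 B1.
have D0 : bdB B = 0.
  apply: ent_inj => s t; rewrite ent0; apply/eqP; apply: contraT.
  move=> /(@hom_bdB B)[sB tB c e].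
  have leB : (deg s <= #|B|)%N := subset_leq_card sB.
  have s1 : deg s = 1%N by lia.
  have t0 : t = set0 by apply: cards0_eq; rewrite -/(deg t); lia.
  have /cards1P[a sa] : #|s| == 1%N by rewrite -/(deg s) s1.
  have aB : a \in B by rewrite (subsetP sB) // sa inE.
  have a0 : a = set0 by rewrite -(cover1 a) -sa e t0 /cover big_set0.
  by rewrite a0 (negPf B0) in aB.
exists 0, (onB B); split.
- split; rewrite ?D0 ?mul0mx ?mulmx0 ?addr0 ?subrr ?pmx_idem //.
    by move=> s t; rewrite ent0 eqxx.
  exact: hom_onB.
- by exists B, B; rewrite ent_onB eqxx subxx oner_eq0.
- by move=> s t /(@hom_onB B)[sB _ _ _]; apply: subset_leq_card.
Qed.

(* A homology class of [B] of top degree, together with a cocycle detecting it,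
   survives in [B'] because each cover occurring in [B] occurs in [B'] with the
   same supporting sets: [p D' = 0] and [D' p = 0] still hold. *)
Lemma homology_top_mono B B' n n' :
  B \subset B' ->
  (forall s t, s \subset B' -> t \subset B -> cover s = cover t ->
    s \subset B) ->
  homology_top B n -> homology_top B' n' -> (n <= n')%N.
Proof.
move=> BB' sat [T [p [[_ hp _ [pD Dp] pp] [s [t [cs nz]]] _]]].
move=> [T' [p' [[hT' hp' E' _ _] _ ub]]]; rewrite leqNgt; apply/negP => ltn.
have entDB u v : ent (bdB B) u v = if u \subset B then ent (bdB B') u v else 0.
  by rewrite !ent_bdB; case: ifP => // uB; rewrite (subset_trans uB).
have DB : bdB B = onB B *m bdB B'.
  by apply: ent_inj => u v; rewrite entDB [RHS]entMpl.
have D'p : bdB B' *m p = 0.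
  rewrite -[RHS]Dp; apply: ent_inj => u v; rewrite entM [RHS]entM;
    apply: eq_bigr => w _.
  have [->|/hp[wB _ _ _]] := eqVneq (ent p w v) 0; first by rewrite !mulr0.
  rewrite entDB; case: ifPn => // uB.
  have [->|/(@hom_bdB B')[uB' _ _ cu]] := eqVneq (ent (bdB B') u w) 0.
    by rewrite mul0r.
  by rewrite (sat _ _ uB' wB cu) in uB.
have pD' : p *m bdB B' = 0 by rewrite -(hom_onBr hp) -mulmxA -DB pD.
(* [onB B' - p'] is null-homotopic, so it vanishes between two copies of [p]. There [onB B'] acts as
   the identity, while [p'] has no nonzero row in degree [n > n']; so the entry of [p] at [s], [t]
   would be zero. *)
have : ent (p *m (onB B' - p') *m p) s t = 0.
  by rewrite -E' mulmxDr mulmxDl !mulmxA pD' !mul0mx add0r -!mulmxA D'p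
    !mulmx0 ent0.
rewrite mulmxBr mulmxBl.
have -> : p *m onB B' = p.
  apply: (hom_onBr (i := 0%N) (j := 0%N)) => u v /hp[uB vB c e].
  by split=> //; apply: subset_trans BB'.
rewrite pp entD entN; have -> : ent (p *m p' *m p) s t = 0.
  apply/eqP; apply: contraT => /entM_neq0[u /entM_neq0[v /hp[_ _ c _] /ub]].
  by rewrite leqNgt; lia.
by rewrite oppr0 addr0 => /eqP; rewrite (negPf nz).
Qed.

(** * Tensor products of scalar complexes *)

Definition sign_mx B : mat :=
  imx (fun s t => if (s == t) && (s \subset B) then (-1) ^+ deg s else 0).

Lemma ent_sign_mx B s t :
  ent (sign_mx B) s t = if (s == t) && (s \subset B) then (-1) ^+ deg s else 0.
Proof. by rewrite ent_imx. Qed.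

Lemma entMsl B X s t :
  ent (sign_mx B *m X) s t =
    if s \subset B then (-1) ^+ deg s * ent X s t else 0.
Proof.
rewrite entM (bigD1 s) //= big1 ?addr0 => [|u /negPf us].
  by rewrite ent_sign_mx eqxx /=; case: ifP; rewrite ?mul0r.
by rewrite ent_sign_mx eq_sym us mul0r.
Qed.

Lemma entMsr B X s t :
  ent (X *m sign_mx B) s t =
    if t \subset B then ent X s t * (-1) ^+ deg t else 0.
Proof.
rewrite entM (bigD1 t) //= big1 ?addr0 => [|u /negPf ut].
  by rewrite ent_sign_mx eqxx /=; case: ifP; rewrite ?mulr0.
by rewrite ent_sign_mx ut mulr0.
Qed.

Lemma hom_sign_mx B : hom B 0 0 (sign_mx B).
Proof.
move=> s t; rewrite ent_sign_mx; have [<-|_] := eqVneq s t;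
  last by rewrite eqxx.
by have [sB|_] := boolP (s \subset B); rewrite ?eqxx.
Qed.

Lemma sign_mx_sqr B : sign_mx B *m sign_mx B = onB B.
Proof.
apply: ent_inj => s t; rewrite entMsl ent_sign_mx ent_onB.
case: (s \subset B); rewrite ?andbT ?andbF //.
by case: eqP; rewrite ?mulr0 // -expr2 sqrr_sign.
Qed.

(** [X] changes the degree by [j - i], which has the parity of [i + j]. *)
Lemma sign_mx_comm B i j X : hom B i j X ->
  X *m sign_mx B = (-1) ^+ (i + j) *: (sign_mx B *m X).
Proof.
move=> hX; apply: ent_inj => s t; rewrite entMsr [RHS]mxE -/(ent _ s t) entMsl.
have [->|/hX[sB tB c _]] := eqVneq (ent X s t) 0.
  by rewrite mul0r mulr0 !if_same mulr0.
rewrite sB tB mulrA -exprD mulrC; congr (_ * _).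
by rewrite -signr_odd -[in RHS]signr_odd; congr (_ ^+ _); lia.
Qed.

Section Tensor.
Variables B1 B2 : {set {set V}}.
Hypothesis disjB : [disjoint B1 & B2].

(** The Kronecker product, with a face [s] of the union read as the pair of its traces on [B1] and
    [B2]. *)
Definition tens X Y : mat := imx (fun s t : {set {set V}} =>
  if (s \subset B1 :|: B2) && (t \subset B1 :|: B2)
  then ent X (s :&: B1) (t :&: B1) * ent Y (s :&: B2) (t :&: B2) else 0).

Lemma ent_tens X Y s t : ent (tens X Y) s t =
  if (s \subset B1 :|: B2) && (t \subset B1 :|: B2)
  then ent X (s :&: B1) (t :&: B1) * ent Y (s :&: B2) (t :&: B2) else 0.
Proof. by rewrite ent_imx. Qed.

Lemma tensDl X X' Y : tens (X + X') Y = tens X Y + tens X' Y.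
Proof.
apply: ent_inj => s t; rewrite entD !ent_tens; case: ifP => _.
  by rewrite entD mulrDl.
by rewrite addr0.
Qed.

Lemma tensDr X Y Y' : tens X (Y + Y') = tens X Y + tens X Y'.
Proof.
apply: ent_inj => s t; rewrite entD !ent_tens; case: ifP => _.
  by rewrite entD mulrDr.
by rewrite addr0.
Qed.

Lemma tensNl X Y : tens (- X) Y = - tens X Y.
Proof.
apply: ent_inj => s t; rewrite entN !ent_tens; case: ifP => _.
  by rewrite entN mulNr.
by rewrite oppr0.
Qed.

Lemma tensNr X Y : tens X (- Y) = - tens X Y.
Proof.
apply: ent_inj => s t; rewrite entN !ent_tens; case: ifP => _.
  by rewrite entN mulrN.
by rewrite oppr0.
Qed.

Lemma tens0l Y : tens 0 Y = 0.
Proof.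
by apply: ent_inj => s t; rewrite ent_tens !ent0 mul0r if_same.
Qed.

Lemma tens0r X : tens X 0 = 0.
Proof.
by apply: ent_inj => s t; rewrite ent_tens !ent0 mulr0 if_same.
Qed.

Lemma setIU_split s t : s \subset B1 -> t \subset B2 ->
  ((s :|: t) :&: B1 = s) * ((s :|: t) :&: B2 = t).
Proof.
move=> s1 t2; rewrite !setIUl (setIidPl s1) (setIidPl t2).
have -> : t :&: B1 = set0.
  apply/eqP; rewrite setI_eq0 disjoint_sym.
  exact: disjointWr t2 disjB.
have -> : s :&: B2 = set0.
  by apply/eqP; rewrite setI_eq0; apply: disjointWl s1 disjB.
by rewrite setU0 set0U.
Qed.

Lemma setU_split s : s \subset B1 :|: B2 -> (s :&: B1) :|: (s :&: B2) = s.
Proof. by move=> sB; rewrite -setIUr; apply/setIidPl. Qed.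

(** Homogeneity of [X] and [Y] confines the intermediate indices to faces of [B1] and of [B2], and
    such pairs correspond to faces of the union. *)
Lemma tensM i j i' j' X X' Y Y' : hom B1 i j X -> hom B2 i' j' Y ->
  tens X Y *m tens X' Y' = tens (X *m X') (Y *m Y').
Proof.
move=> hX hY; apply: ent_inj => s t; rewrite entM ent_tens.
case: (boolP (s \subset _)) => sB /=; last first.
  by rewrite big1 // => u _; rewrite ent_tens (negPf sB) mul0r.
case: (boolP (t \subset _)) => tB /=; last first.
  by rewrite big1 // => u _;
    rewrite [ent (tens X' _) _ _]ent_tens (negPf tB) andbF mulr0.
rewrite !entM big_distrlr /= pair_big /=.
rewrite [RHS](bigID (fun q : {set {set V}} * {set {set V}} =>
  (q.1 \subset B1) && (q.2 \subset B2))) /=.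
rewrite [X in _ + X]big1 ?addr0 => [|q]; last first.
  rewrite negb_and => nq.
  have [->|/hX[_ q1 _ _]] := eqVneq (ent X (s :&: B1) q.1) 0;
    first by rewrite !mul0r.
  have [->|/hY[_ q2 _ _]] := eqVneq (ent Y (s :&: B2) q.2) 0.
    by rewrite mul0r mulr0.
  by rewrite q1 q2 in nq.
rewrite (bigID (fun u : {set {set V}} => u \subset B1 :|: B2)) /=.
rewrite [X in _ + X]big1 ?addr0 => [|u uB]; last first.
  by rewrite ent_tens (negPf uB) andbF mul0r.
rewrite [RHS](reindex_onto (fun u : {set {set V}} => (u :&: B1, u :&: B2))
  (fun q => q.1 :|: q.2)) /=; last first.
  by move=> [q1 q2] /= /andP[h1 h2]; rewrite !(setIU_split h1 h2).
apply: eq_big => [u|u uB].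
  rewrite !subsetIr /=; apply/idP/eqP => [|<-]; first exact: setU_split.
  by rewrite setUSS ?subsetIr.
by rewrite !ent_tens sB uB tB /=; ring.
Qed.

Lemma deg_split s : s \subset B1 :|: B2 ->
  deg s = (deg (s :&: B1) + deg (s :&: B2))%N.
Proof.
move=> sB; rewrite -{1}(setU_split sB) /deg cardsU [X in (_ - X)%N]eq_card0
  ?subn0 //.
move=> a; rewrite !inE; apply/negbTE/negP => /andP[/andP[_ a1] /andP[_ a2]].
by have := disjointFr disjB a1; rewrite a2.
Qed.

Lemma coverU s t : cover (s :|: t) = cover s :|: cover t.
Proof. exact: bigcup_setU. Qed.

Lemma homT i j i' j' X Y : hom B1 i j X -> hom B2 i' j' Y ->
  hom (B1 :|: B2) (i + i') (j + j') (tens X Y).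
Proof.
move=> hX hY s t; rewrite ent_tens; case: ifP => [/andP[sB tB]|];
  last by rewrite eqxx.
rewrite mulf_eq0 negb_or => /andP[/hX[_ _ c1 e1] /hY[_ _ c2 e2]]; split=> //.
  by rewrite (deg_split sB) (deg_split tB); lia.
by rewrite -(setU_split sB) -(setU_split tB) !coverU e1 e2.
Qed.

Lemma tens_onB : tens (onB B1) (onB B2) = onB (B1 :|: B2).
Proof.
apply: ent_inj => s t; rewrite ent_tens !ent_onB !subsetIr !andbT.
case: (boolP (s \subset _)) => sB /=; last by rewrite andbF.
rewrite andbT; case: (boolP (t \subset _)) => tB /=; last first.
  by case: eqP => // e; rewrite e (negPf tB) in sB.
have -> : (s == t) = (s :&: B1 == t :&: B1) && (s :&: B2 == t :&: B2).
  apply/eqP/andP => [->//|[/eqP e1 /eqP e2]].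
  by rewrite -(setU_split sB) -(setU_split tB) e1 e2.
by rewrite -natrM mulnb.
Qed.

Hypothesis rB : forall a b, a \in B1 -> b \in B2 -> (r a < r b)%N.
Hypothesis disjC : forall a b, a \in B1 -> b \in B2 -> [disjoint a & b].

Lemma cover_disj s t : s \subset B1 -> t \subset B2 ->
  [disjoint cover s & cover t].
Proof.
move=> s1 t2; rewrite disjoints_subset; apply/subsetP => x /bigcupP[a sa ax].
rewrite inE; apply/negP => /bigcupP[b tb bx].
have := disjC (subsetP s1 _ sa) (subsetP t2 _ tb).
by move/disjointFr => /(_ _ ax); rewrite bx.
Qed.

Lemma cover_split s t : s \subset B1 :|: B2 -> t \subset B1 :|: B2 ->
  (cover s == cover t) =
  (cover (s :&: B1) == cover (t :&: B1)) && (cover (s :&: B2) == cover (t :&: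
    B2)).
Proof.
move=> sB tB; apply/eqP/andP => [e|[/eqP e1 /eqP e2]]; last first.
  by rewrite -(setU_split sB) -(setU_split tB) !coverU e1 e2.
rewrite -(setU_split sB) -(setU_split tB) !coverU in e.
have d u v := cover_disj (subsetIr u B1) (subsetIr v B2).
split; apply/eqP/setP => x; have /setP/(_ x) := e; rewrite !inE.
  have [x1|] := boolP (x \in cover (s :&: B1)).
    by have /disjointFr/(_ x1)-> := d s t; rewrite orbF /=.
  have [x2|] := boolP (x \in cover (t :&: B1)) => //.
  by have /disjointFr/(_ x2)-> := d t s.
have [x1|] := boolP (x \in cover (s :&: B2)).
  by have /disjointFl/(_ x1)-> := d t s; rewrite orbT /=.
have [x2|] := boolP (x \in cover (t :&: B2)) => //.
by have /disjointFl/(_ x2)-> := d s t; rewrite orbT.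
Qed.

Lemma below_split1 s a : s \subset B1 :|: B2 -> a \in B1 ->
  below r s a = below r (s :&: B1) a.
Proof.
move=> sB aB; rewrite /below; apply: eq_card => b; rewrite !inE.
have [sb|] //= := boolP (b \in s).
have := subsetP sB _ sb; rewrite inE => /orP[->|b2] //.
by rewrite ltnNge (ltnW (rB aB b2)) andbF.
Qed.

(** Every label of [B1] precedes [a]; the term [deg (s :&: B1)] produces the Koszul sign. *)
Lemma below_split2 s a : s \subset B1 :|: B2 -> a \in B2 ->
  below r s a = (deg (s :&: B1) + below r (s :&: B2) a)%N.
Proof.
move=> sB aB; rewrite /below /deg.
rewrite -(cardsID B1 [set b in s | (r b < r a)%N]); congr (_ + _)%N;
  apply: eq_card => b.
  rewrite !inE; case: (b \in s) => //=.
  by have [b1|] := boolP (b \in B1); rewrite ?andbF // (rB b1 aB).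
rewrite !inE andbA; congr (_ && _); rewrite andbC.
have [sb|] //= := boolP (b \in s).
have := subsetP sB _ sb; rewrite inE => /orP[b1|b2].
  by rewrite b1 (disjointFr disjB b1).
by rewrite b2 (disjointFl disjB b2).
Qed.

(** The Leibniz rule: the removed element lies in exactly one factor, and [sign_mx B1] is the Koszul
    sign from passing the first factor. Disjoint covers let the weight split in the same way. *)
Lemma tens_bdB :
  bdB (B1 :|: B2) = tens (bdB B1) (onB B2) + tens (sign_mx B1) (bdB B2).
Proof.
apply: ent_inj => s t; rewrite entD !ent_tens.
have hB := @hom_bdB (B1 :|: B2).
case: (boolP (s \subset _)) => sB /=; last first.
  rewrite addr0; apply/eqP; apply: contraNT sB; by move/hB => [].
case: (boolP (t \subset _)) => tB /=; last first.
  rewrite addr0; apply/eqP; apply: contraNT tB; by move/hB => [].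
rewrite !ent_bdB sB !subsetIr ent_onB ent_sign_mx !subsetIr !andbT !ent_imx.
rewrite (bigID (mem B1)) /=; congr (_ + _).
  rewrite mulr_suml; rewrite [LHS](eq_bigl (fun a => (a \in s :&: B1) &&
    ((t :&: B1 == (s :&: B1) :\ a) && (s :&: B2 == t :&: B2)))); last first.
    move=> a /=; have [a1|a1] := boolP (a \in B1); rewrite inE; last first.
      by rewrite (negPf a1) !andbF.
    rewrite a1 !andbT; congr (_ && _).
    have a2 : a \notin B2 by rewrite (disjointFr disjB a1).
    apply/eqP/andP => [->|[/eqP e1 /eqP e2]].
      split; first by rewrite setIDAC.
      by rewrite setIDAC; apply/eqP/esym/setDidPl;
        rewrite disjoint_sym disjoints1 inE negb_and a2 orbT.
    rewrite -(setU_split tB) e1 -e2 -[in RHS](setU_split sB) setDUl;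
      congr (_ :|: _).
    by apply/esym/setDidPl;
      rewrite disjoint_sym disjoints1 inE negb_and a2 orbT.
  rewrite big_mkcondr /= [RHS]big_mkcondr /=; apply: eq_bigr => a.
  rewrite inE => /andP[sa a1]; case: eqP => e1 /=; last by [].
  case: eqP => e2 /=; last by rewrite mulr0.
  rewrite mulr1 /sgn (below_split1 sB a1) /cover_weight cover_split // e2 eqxx
    andbT.
  by [].
rewrite [LHS](eq_bigl (fun a => (a \in s :&: B2) &&
    ((t :&: B2 == (s :&: B2) :\ a) && (s :&: B1 == t :&: B1)))); last first.
  move=> a /=; rewrite inE; have [sa|] //= := boolP (a \in s).
  have := subsetP sB _ sa; rewrite inE => /orP[a1|a2].
    by rewrite a1 (disjointFr disjB a1) andbF.
  have a1 : a \in B1 = false by rewrite (disjointFl disjB a2).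
  rewrite a1 a2 andbT /=.
  apply/eqP/andP => [->|[/eqP e1 /eqP e2]].
    split; first by rewrite setIDAC.
    by rewrite setIDAC; apply/eqP/esym/setDidPl;
      rewrite disjoint_sym disjoints1 inE negb_and a1 orbT.
  rewrite -(setU_split tB) e1 -e2 -[in RHS](setU_split sB) setDUl;
    congr (_ :|: _).
  by apply/esym/setDidPl; rewrite disjoint_sym disjoints1 inE negb_and a1 orbT.
rewrite mulr_sumr big_mkcondr /= [RHS]big_mkcondr /=; apply: eq_bigr => a.
rewrite inE => /andP[sa a2]; case: eqP => e1 /=; last by [].
case: eqP => e2 /=; last by rewrite mul0r.
rewrite /sgn (below_split2 sB a2) exprD /cover_weight cover_split // e2 eqxx /=.
by rewrite mulrA.
Qed.

(** A Künneth formula: [T1 (x) 1 + J p1 (x) T2] is a homotopy from the identity to [p1 (x) p2]. The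
    sign [J] makes the mixed terms cancel, and nonzero entries of [p1] and [p2] have a nonzero
    product. *)
Lemma homology_top_tens n1 n2 : homology_top B1 n1 -> homology_top B2 n2 ->
  homology_top (B1 :|: B2) (n1 + n2).
Proof.
move=> [T1 [p1 [[hT1 hp1 E1 [pD1 Dp1] pp1] [s1 [t1 [cs1 nz1]]] ub1]]].
move=> [T2 [p2 [[hT2 hp2 E2 [pD2 Dp2] pp2] [s2 [t2 [cs2 nz2]]] ub2]]].
have hD1 := @hom_bdB B1; have hD2 := @hom_bdB B2.
have hJ := @hom_sign_mx B1; have h1 := @hom_onB B1; have h2 := @hom_onB B2.
set D1 := bdB B1 in E1 pD1 Dp1 hD1; set D2 := bdB B2 in E2 pD2 Dp2 hD2.
set J := sign_mx B1 in hJ; set I1 := onB B1 in E1 h1; set I2 := onB B2 in E2 h2.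
have hJp := homM hJ hp1.
have JD : D1 *m J = - (J *m D1).
  by rewrite (sign_mx_comm hD1) addn0 expr1 scaleN1r.
have JT : T1 *m J = - (J *m T1).
  by rewrite (sign_mx_comm hT1) add0n expr1 scaleN1r.
have Jp : p1 *m J = J *m p1.
  by rewrite (sign_mx_comm hp1) expr0 scale1r.
have JJ : J *m J = I1 by apply: sign_mx_sqr.
exists (tens T1 I2 + tens (J *m p1) T2), (tens p1 p2); split; first split.
- by apply: homD; [apply: homT hT1 h2 | apply: homT hJp hT2].
- exact: homT hp1 hp2.
- rewrite tens_bdB -/D1 -/D2 -/I2 -/J.
  rewrite !mulmxDl !mulmxDr.
  rewrite !(tensM _ _ hD1 h2) !(tensM _ _ hJ hD2) !(tensM _ _ hT1 h2) !(tensM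
    _ _ hJp hT2).
  rewrite (hom_onBl hD2) (hom_onBl hT2) (hom_onBr hD2) (hom_onBr hT2)
    (hom_onBr h2).
  rewrite [D1 *m (J *m p1)]mulmxA JD mulNmx -!mulmxA Dp1 pD1 Jp !mulmxA JJ.
  rewrite !mulmx0 oppr0 JT !tens0l.
  rewrite (hom_onBl hp1) tensNl -tens_onB -/I1 -/I2.
  have -> : tens (D1 *m T1) I2 = tens (I1 - p1) I2 - tens (T1 *m D1) I2.
    by rewrite -E1 tensDl addrK.
  have -> : tens p1 (D2 *m T2) = tens p1 (I2 - p2) - tens p1 (T2 *m D2).
    by rewrite -E2 tensDr addrK.
  rewrite tensDl tensDr tensNl tensNr.
  set x1 := tens I1 I2; set x2 := tens p1 I2; set x3 := tens _ (T2 *m D2).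
  set x4 := tens (T1 *m D1) I2; set x5 := tens (J *m T1) D2;
    set x6 := tens p1 p2.
  by apply: ent_inj => s t; rewrite !(entD, entN, ent0); ring.
- rewrite tens_bdB -/D1 -/D2 -/I2 -/J mulmxDl mulmxDr; split.
    rewrite !(tensM _ _ hp1 hp2) pD1 pD2 tens0l tens0r addr0 //.
  by rewrite (tensM _ _ hD1 h2) (tensM _ _ hJ hD2) Dp1 Dp2 tens0l tens0r addr0.
- by rewrite (tensM _ _ hp1 hp2) pp1 pp2.
- have [s1B t1B _ _] := hp1 _ _ nz1; have [s2B t2B _ _] := hp2 _ _ nz2.
  exists (s1 :|: s2), (t1 :|: t2); split.
    by rewrite deg_split ?setUSS // !(setIU_split s1B s2B) cs1 cs2.
  by rewrite ent_tens !setUSS //= !(setIU_split s1B s2B) !(setIU_split t1B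
    t2B) mulf_neq0.
- move=> s t; rewrite ent_tens; case: ifP => [/andP[sB tB]|];
  last by rewrite eqxx.
  rewrite mulf_eq0 negb_or => /andP[/ub1 c1 /ub2 c2].
  by rewrite (deg_split sB) leq_add.
Qed.

End Tensor.

End ScalarComplex.

(** * The Taylor resolution of an edge ideal *)
Lemma mcoeff_mulX_neq0 (R : nzRingType) n (p : {mpoly R[n]}) (m a : 'X_{1..n}) :
  (p * 'X_[m])@_a != 0 -> (m <= a)%MM.
Proof.
move=> nz; have : a \in msupp (p * 'X_[m]) by rewrite mcoeff_msupp.
move/msuppM_le/allpairsP => -[[a1 a2] /= [_]].
by rewrite msuppX inE => /eqP-> ->; apply: lem_addl.
Qed.

(** Edges are two-element sets of vertices of the ambient graph, so that the complexes of all
    induced subgraphs share one index type. *)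
Definition edge_sets (G : sgraph) (S : {set G}) : {set {set G}} :=
  [set a | [exists x : G, exists y : G,
     [&& edge x y, a == [set x; y] & a \subset S]]].

Lemma edge_setsP (G : sgraph) (S : {set G}) a :
  reflect (exists x y, [/\ edge x y, a = [set x; y] & a \subset S])
          (a \in edge_sets S).
Proof.
rewrite inE; apply: (iffP existsP) => [[x /existsP[y /and3P[xy /eqP aE aS]]]|].
  by exists x, y.
move=> [x [y [xy aE aS]]]; exists x; apply/existsP; exists y.
by rewrite xy aS aE eqxx.
Qed.

Section Taylor.
Variables (k : fieldType) (G H : sgraph) (iota : H -> G) (r : {set G} -> nat).
Hypothesis iota_inj : injective iota.
Hypothesis iota_edge : forall u v, edge (iota u) (iota v) = edge u v.
Hypothesis r_inj : injective r.

Local Notation R := {mpoly k[#|H|]}.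
Local Notation B := (edge_sets [set iota u | u in H]).
Implicit Types (s t : {set {set G}}) (a e : {set G}).

(** The exponent of the least common multiple of the edges in [s]. Faces consist of edges of [G],
    the variables are those of [H], and [iota] translates between them. *)
Definition cover_mnm s : 'X_{1..#|H|} :=
  [multinom ((iota (enum_val i) \in cover s) : nat) | i < #|H|].

Lemma cover_mnmS s t : s \subset t -> (cover_mnm s <= cover_mnm t)%MM.
Proof.
move=> st; apply/mnm_lepP => i; rewrite !mnmE.
have [/(subsetP (coverS st))->//|//] := boolP (_ \in cover s).
Qed.

Lemma cover_mnm_le s (m : 'X_{1..#|H|}) :
  (forall a, a \in s -> (cover_mnm [set a] <= m)%MM) -> (cover_mnm s <= m)%MM.
Proof.
move=> sm; apply/mnm_lepP => i; rewrite mnmE.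
have [/bigcupP[a sa ia]|//] := boolP (_ \in cover s).
by have /mnm_lepP/(_ i) := sm a sa; rewrite mnmE cover1 ia.
Qed.

Definition taylor_weight s t : R := 'X_[cover_mnm s - cover_mnm t].

Lemma taylor_weightE s t : t \subset s ->
  taylor_weight s t * 'X_[cover_mnm t] = 'X_[cover_mnm s].
Proof. by move=> ts; rewrite -mpolyXD submK // cover_mnmS. Qed.

Lemma taylor_weightM s a e : a \in s -> e \in s -> a != e ->
  taylor_weight s (s :\ a) * taylor_weight (s :\ a) (s :\ a :\ e) =
  taylor_weight s (s :\ a :\ e).
Proof.
move=> _ _ _; rewrite /taylor_weight -mpolyXD; congr 'X_[_].
apply/mnmP => i; rewrite mnmDE !mnmBE.
have /mnm_lepP/(_ i) := cover_mnmS (subsetDl s [set a]).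
have /mnm_lepP/(_ i) := cover_mnmS (subsetDl (s :\ a) [set e]).
lia.
Qed.

Definition taylor : 'M[R]_#|{set {set G}}| := bd r taylor_weight.

Lemma taylor_taylor : taylor *m taylor = 0.
Proof. exact: bd_bd taylor_weightM. Qed.

Definition grade_mx i : 'M[R]_#|{set {set G}}| :=
  pmx R [pred s : {set {set G}} | (s \subset B) && (deg s == i)].

Lemma sgn_mcoeff s a (p : R) m : (sgn r R s a * p)@_m = sgn r k s a * p@_m.
Proof.
by rewrite -(map_sgn r (@mpolyC #|H| k)) mcoeffCM.
Qed.

(** After multiplying each entry by the monomial of its face, the Taylor differential becomes the
    unweighted boundary, which can be studied one monomial at a time. *)
Lemma taylor_row_mulX (v : 'rV[R]_#|{set {set G}}|) t :
  vent (v *m taylor) t * 'X_[cover_mnm t] =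
  \sum_(a | a \notin t) sgn r R (a |: t) a *
    (vent v (a |: t) * 'X_[cover_mnm (a |: t)]).
Proof.
rewrite ventM bd_col mulr_suml; apply: eq_bigr => a _.
by rewrite -(taylor_weightE (subsetUr [set a] t)); ring.
Qed.

(** * Exactness of the Taylor complex *)

Section Exactness.
Variable v : 'rV[R]_#|{set {set G}}|.
Hypothesis vB : forall s, ~~ (s \subset B) -> vent v s = 0.
Hypothesis vcycle : v *m taylor = 0.
Hypothesis v0 : forall m, (vent v set0)@_m != 0 ->
  exists2 a, a \in B & (cover_mnm [set a] <= m)%MM.

Let g s : R := vent v s * 'X_[cover_mnm s].

(** [msize] exceeds the degree by one, so every monomial of every [g s] has degree below [bound],
    and the sum defining [w] is finite. *)
Let bound := (\max_(s : {set {set G}}) msize (g s))%N.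

(* In each multidegree [m], contract by inserting a fixed edge dividing [m]. *)
Let pivot (m : 'X_{1..#|H|}) :=
  [pick a in B | (cover_mnm [set a] <= m)%MM].

Let hcoef s (m : 'X_{1..#|H|}) : k :=
  if pivot m is Some a then
    if (a \in s) && (s \subset B) then sgn r k s a * (g (s :\ a))@_m else 0
  else 0.

Let w : 'rV[R]_#|{set {set G}}| := \row_i
  \sum_(m : 'X_{1..#|H| < bound})
     hcoef (enum_val i) m *: 'X_[m - cover_mnm (enum_val i)].

Lemma g_coef s m : (g s)@_m != 0 -> (cover_mnm s <= m)%MM.
Proof. exact: mcoeff_mulX_neq0. Qed.

(** The pivot divides [m] by choice, and the remaining edges of [s] do because [g (s :\ a)] contains
    [m]. Hence the truncated subtraction in [w] is a true division. *)
Lemma hcoef_neq0 s m : hcoef s m != 0 -> (cover_mnm s <= m)%MM.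
Proof.
rewrite /hcoef /pivot; case: pickP => [a /andP[aB am]|_]; last by rewrite eqxx.
case: ifP => [/andP[sa sB]|]; last by rewrite eqxx.
rewrite mulf_eq0 negb_or => /andP[_ /g_coef gm].
apply: cover_mnm_le => e se; have [->//|ea] := eqVneq e a.
by apply: lepm_trans gm; apply: cover_mnmS; rewrite sub1set !inE ea.
Qed.

Lemma w_mulX_coef s m : (vent w s * 'X_[cover_mnm s])@_m = hcoef s m.
Proof.
rewrite /vent mxE enum_rankK mulr_suml.
under eq_bigr => m' _.
  have -> : hcoef s m' *: 'X_[m' - cover_mnm s] * 'X_[cover_mnm s] =
            hcoef s m' *: 'X_[m'] :> R.
    have [->|/hcoef_neq0 le] := eqVneq (hcoef s m') 0.
      by rewrite !scale0r mul0r.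
    by rewrite -scalerAl -mpolyXD submK.
  over.
have [lt|ge] := ltnP (mdeg m) bound; first by rewrite mcoeff_mpoly.
rewrite raddf_sum /= big1 => [|m' _]; last first.
  rewrite mcoeffZ mcoeffX; case: eqP => [e|]; last by rewrite mulr0.
  by have := bmdeg m'; rewrite e ltnNge ge.
apply/esym; rewrite /hcoef; case: (pivot m) => // a; case: ifP => // _.
apply/eqP; rewrite mulf_eq0; apply/orP; right.
rewrite mcoeff_eq0; apply: msize_mdeg_ge; apply: leq_trans ge.
exact: leq_bigmax.
Qed.

(** In each multidegree [w] is the cone over [v] with the pivot as apex, and a cycle is the boundary
    of its cone. *)
Lemma taylor_exact_gen : w *m taylor = v.
Proof.
apply: vent_inj => t; apply: (@mulIf _ 'X_[cover_mnm t]).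
  by rewrite -msize_poly_eq0 msizeX.
rewrite taylor_row_mulX -/(g t); apply/mpolyP => m.
rewrite raddf_sum /=; under eq_bigr do rewrite sgn_mcoeff w_mulX_coef.
have [tB|tB] := boolP (t \subset B); last first.
  rewrite /g (vB tB) mul0r mcoeff0 big1 // => a _.
  rewrite /hcoef; case: (pivot m) => [e|]; last by rewrite mulr0.
  rewrite ifF ?mulr0 //; apply/negbTE; apply: contra tB => /andP[_].
  exact/subset_trans/subsetUr.
have gsum (u : {set {set G}}) : \sum_(a | a \notin u) sgn r k (a |: u) a * (g
  (a |: u))@_m = 0.
  have := taylor_row_mulX v u; rewrite vcycle /vent mxE mul0r.
  move/(congr1 (mcoeff m)); rewrite mcoeff0 raddf_sum /= => e.
  by rewrite [RHS]e; apply: eq_bigr => a _; rewrite sgn_mcoeff.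
(* If no edge divides [m], both sides vanish: a nonempty [t] would contain an edge dividing [m], and
   [t = set0] is excluded by [v0]. *)
rewrite /hcoef /pivot; case: pickP => [e /andP[eB em]|none]; last first.
  rewrite big1 => [|a _]; last by rewrite mulr0.
  apply/esym/eqP; apply: contraT => gm.
  have [t0|[a ta]] := set_0Vmem t.
    have [|a aB am] := v0 (m := m).
      move: gm; rewrite /g t0 (_ : cover_mnm set0 = 0%MM) ?mpolyX0 ?mulr1 //.
      by apply/mnmP => i; rewrite !mnmE /cover big_set0 inE.
    by have := none a; rewrite /= aB am.
  have := none a; rewrite /= (subsetP tB _ ta) /=.
  by rewrite (lepm_trans _ (g_coef gm)) // cover_mnmS // sub1set.
(* When the apex [e] is outside [t], only the term [a = e] contributes. *)
have [te|te] := boolP (e \in t); last first.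
  rewrite (bigD1 e) //= setU11 subUset sub1set eB tB /= big1 ?addr0 => [|a].
    by rewrite mulrA sgn_sqr mul1r setU1K.
  case/andP=> ta ae; have -> : (e \in a |: t) = false; last by rewrite mulr0.
  by rewrite !inE (negPf te) orbF eq_sym (negPf ae).
(* When [e] is in [t], exchanging the removals of [a] and [e] flips the sign. The sum becomes the
   cycle relation at [t :\ e] without its term [a = e], and that term is [g t] up to sign. *)
transitivity (- sgn r k t e *
  \sum_(a | a \notin t) sgn r k (a |: (t :\ e)) a * (g (a |: (t :\ e)))@_m).
  rewrite mulr_sumr; apply: eq_bigr => a ta.
  have ae : a != e by apply: contraNneq ta => ->.
  have sE : (a |: t) :\ e = a |: (t :\ e).
    by rewrite setDUl; congr (_ :|: _); apply/setDidPl; rewrite disjoints1 inE.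
  rewrite setU1r //= subUset sub1set tB andbT sE.
  case: ifPn => aB; last first.
    have -> : g (a |: t :\ e) = 0.
      rewrite /g vB ?mul0r //; apply: contra aB => /subsetP; apply.
      by rewrite setU11.
    by rewrite mcoeff0 !mulr0.
  rewrite !mulrA; congr (_ * _).
  have := sgn_anti r_inj k (setU1r a te) (setU11 a t) (_ : e != a).
  rewrite eq_sym ae setU1K // sE => /(_ isT) anti.
  have q1 := sgn_sqr r k t e; have q2 := sgn_sqr r k (a |: t) e.
  transitivity (- (sgn r k t e * sgn r k (a |: t) e) *
     (- (sgn r k (a |: t) a * sgn r k t e))).
    rewrite mulrN mulNr opprK -[LHS]mulr1 -q1; ring.
  rewrite -anti -[RHS]mulr1 -q2; ring.
have := gsum (t :\ e); rewrite (bigD1 e) ?inE ?eqxx //= setD1K //.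
rewrite [X in _ + X](eq_bigl (fun a => a \notin t)) => [/eqP|a]; last first.
  by rewrite !inE; have [->|] := eqVneq a e; rewrite ?andbF ?andbT ?te.
rewrite addrC addr_eq0 => /eqP->.
by rewrite mulrNN mulrA sgn_sqr mul1r.
Qed.

Lemma w_neq0 s : vent w s != 0 -> exists2 a, a \in s & vent v (s :\ a) != 0.
Proof.
rewrite /vent mxE enum_rankK => nz.
have [m] : exists m, hcoef s m != 0.
  apply: contrapT => none; case/eqP: nz; apply: big1 => m _.
  have -> : hcoef s m = 0 by apply/eqP; apply: contra_notT none => ?; exists m.
  by rewrite scale0r.
rewrite /hcoef; case: (pivot m) => [a|]; last by rewrite eqxx.
case: ifP => [/andP[sa sB]|]; last by rewrite eqxx.
rewrite mulf_eq0 negb_or => /andP[_ gm]; exists a => //.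
by apply: contraNneq gm; rewrite /g /vent => ->; rewrite mul0r mcoeff0.
Qed.

Lemma w_subset s : vent w s != 0 -> s \subset B.
Proof.
apply: contraNT => sB; rewrite /vent mxE enum_rankK big1 // => m _.
rewrite /hcoef; case: (pivot m) => [a|]; last by rewrite scale0r.
by rewrite (negPf sB) andbF scale0r.
Qed.

End Exactness.
Lemma taylor_exact i (v : 'rV[R]_#|{set {set G}}|) :
  v *m grade_mx i = v -> v *m taylor = 0 ->
  (i = 0%N -> forall m, (vent v set0)@_m != 0 ->
     exists2 a, a \in B & (cover_mnm [set a] <= m)%MM) ->
  exists w : 'rV[R]_#|{set {set G}}|, w *m grade_mx i.+1 *m taylor = v.
Proof.
move=> vi vcyc v0.
have vsupp s : vent v s != 0 -> (s \subset B) && (deg s == i).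
  by rewrite -{1}vi ventMp /=; case: ifP => //; rewrite eqxx.
have vB s : ~~ (s \subset B) -> vent v s = 0.
  by move=> sB; apply/eqP; apply: contraNT sB => /vsupp/andP[].
have v0' m : (vent v set0)@_m != 0 ->
    exists2 a, a \in B & (cover_mnm [set a] <= m)%MM.
  case: i vi v0 vsupp => [|i] vi v0 vsupp; first exact: v0.
  have -> : vent v set0 = 0; last by rewrite mcoeff0 eqxx.
  by apply/eqP; apply: contraT => /vsupp; rewrite /deg cards0 andbF.
have := taylor_exact_gen vB vcyc v0'; set w := (X in X *m taylor) => wD.
exists w; rewrite -[RHS]wD; congr (_ *m _); apply: vent_inj => s.
rewrite ventMp /=; case: ifPn => // sBi; apply/esym/eqP.
apply: contraNT sBi => ws; rewrite (w_subset ws).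
have [a sa /vsupp/andP[_ /eqP <-]] := w_neq0 ws.
by rewrite /deg [X in X == _](cardsD1 a) sa add1n /=.
Qed.

Lemma cover_mnm_edge u w : edge u w ->
  cover_mnm [set [set iota u; iota w]] = (U_(enum_rank u) + U_(enum_rank w))%MM.
Proof.
move=> uw; apply/mnmP => i;
  rewrite mnmDE !mnm1E mnmE cover1 !inE !(inj_eq iota_inj).
rewrite -[in RHS](enum_valK i) !(inj_eq enum_rank_inj) ![u == _]eq_sym ![w ==
  _]eq_sym.
have [->|_] := eqVneq (enum_val i) u; last by rewrite add0n.
by case: eqVneq uw => // ->; rewrite edge_irr.
Qed.

Lemma edge_setsE a : a \in B ->
  exists u w, edge u w /\ a = [set iota u; iota w].
Proof.
case/edge_setsP=> x [y [xy -> /subsetP S]].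
have /imsetP[u _ xu] := S x (set21 _ _);
  have /imsetP[w _ yw] := S y (set22 _ _).
by exists u, w; rewrite -iota_edge -xu -yw.
Qed.

Lemma edge_sets_mem u w : edge u w -> [set iota u; iota w] \in B.
Proof.
move=> uw; apply/edge_setsP; exists (iota u), (iota w); rewrite iota_edge.
by split=> //; apply/subsetP => x; rewrite !inE => /orP[] /eqP->;
  apply: imset_f.
Qed.

(** The ideal is monomial: each monomial of a member is divisible by a generator. This supplies the
    hypothesis [v0] of exactness in degree zero. *)
Lemma edge_ideal_coef (p : R) m : p \in @edge_ideal k H -> p@_m != 0 ->
  exists2 a, a \in B & (cover_mnm [set a] <= m)%MM.
Proof.
move=> /asboolP[c ->] nz; apply: contrapT => none; case/eqP: nz.
rewrite raddf_sum big1 // => u _; rewrite raddf_sum big1 // => w uw.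
apply/eqP; apply: contra_notT none; rewrite /= /vertex_var -mpolyXD.
move/mcoeff_mulX_neq0; rewrite -(cover_mnm_edge uw) => le.
by exists [set iota u; iota w] => //; apply: edge_sets_mem.
Qed.

Lemma edge_ideal_mulX (p : R) a : a \in B ->
  p * 'X_[cover_mnm [set a]] \in @edge_ideal k H.
Proof.
case/edge_setsE=> u [w [uw ->]]; rewrite cover_mnm_edge // mpolyXD.
apply/asboolP; exists (fun x y => if (x == u) && (y == w) then p else 0).
rewrite (bigD1 u) //= (bigD1 w) //= !eqxx /=.
rewrite big1 ?addr0 => [|y /andP[_ /negPf ->]]; last by rewrite mul0r.
rewrite big1 ?addr0 // => x /negPf xu; rewrite big1 // => y _.
by rewrite xu mul0r.
Qed.

Lemma cover_mnm0 : cover_mnm set0 = 0%MM.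
Proof. by apply/mnmP => i; rewrite !mnmE /cover big_set0 inE. Qed.

Lemma taylor_row_ideal (v : 'rV[R]_#|{set {set G}}|) :
  vent (v *m grade_mx 1 *m taylor) set0 \in @edge_ideal k H.
Proof.
rewrite -[vent _ _]mulr1 -mpolyX0 -cover_mnm0 taylor_row_mulX.
apply: rpred_sum => a _; rewrite mulrA; rewrite setU0 ventMp /= sub1set.
by case: ifP => [/andP[aB _]|_];
  rewrite ?mulr0 ?mul0r ?rpred0 // edge_ideal_mulX.
Qed.

(** Degree zero of the Taylor complex has the empty face as its only basis element, so the
    augmentation reads that entry modulo the ideal. *)
Lemma augmentation : exists eps : {linear 'rV[R]_#|{set {set G}}| ->
  edge_ring k H},
  (forall x, exists c : R, forall v, vent v set0 = c -> eps v = x) /\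
  forall v, eps v = 0 <-> vent v set0 \in @edge_ideal k H.
Proof.
have [|eps epsE] := @linear_of R 'rV[R]_#|{set {set G}}| (edge_ring k H)
  (fun v => (\pi_({ideal_quot (@edge_ideal k H)})%qT (vent v set0))).
  move=> c u v; rewrite /vent !mxE -/(vent _ _) rmorphD rmorphM.
  by [].
exists eps; split=> [x|v]; last first.
  rewrite epsE -(rmorph0 (\pi_({ideal_quot (@edge_ideal k H)})%qT)).
  have := Quotient.idealrBE (@edge_ideal k H) (vent v set0) 0.
  by rewrite subr0 => ->; split=> /eqP.
by exists (repr x) => v vE; rewrite epsE vE reprK.
Qed.
Local Notation tmat := 'M[R]_#|{set {set G}}|.

Definition onBR : tmat := pmx R [pred s : {set {set G}} | s \subset B].

Definition lift_mx (X : 'M[k]_#|{set {set G}}|) : tmat :=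
  map_mx (@mpolyC #|H| k) X.

Lemma ent_lift X s t : ent (lift_mx X) s t = (ent X s t)%:MP.
Proof. exact: ent_map. Qed.

Lemma taylor_neq0 s t : ent taylor s t != 0 ->
  [/\ t \subset s, deg s = (deg t).+1 & cover t \subset cover s].
Proof.
move=> /bd_neq0[a sa tE]; have ts : t \subset s by rewrite tE subsetDl.
by split; rewrite ?coverS // /deg (cardsD1 a s) sa tE.
Qed.

Lemma taylor_cover_eq s t : s \subset B -> cover s = cover t ->
  ent taylor s t = (ent (bdB k r B) s t)%:MP.
Proof.
move=> sB c; rewrite ent_bdB sB !ent_imx rmorph_sum /=; apply: eq_bigr => a _.
rewrite rmorphM map_sgn /taylor_weight /cover_weight c eqxx rmorph1.
have -> : (cover_mnm s - cover_mnm t)%MM = 0%MM.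
  by apply/mnmP => i; rewrite mnmBE mnm0E !mnmE c subnn.
by rewrite mpolyX0.
Qed.

Lemma cover_sub_iota s x : s \subset B -> x \in cover s -> exists u, x = iota u.
Proof.
move=> sB /bigcupP[a /(subsetP sB)/edge_setsP[_ [_ [_ _ aS]]]] /(subsetP aS).
by case/imsetP=> u _ ->; exists u.
Qed.

(** Taking constant coefficients is the reduction modulo the variables. If a vertex is lost from the
    cover, it lies in the image of [iota] and its variable divides the weight. *)
Lemma taylor_mod0 s t : s \subset B ->
  mcoeff 0%MM (ent taylor s t) = ent (bdB k r B) s t.
Proof.
move=> sB; have [c|c] := eqVneq (cover s) (cover t).
  by rewrite taylor_cover_eq // mcoeffC eqxx mulr1.
have -> : ent (bdB k r B) s t = 0.
  by apply/eqP; apply: contraNT c => /(@hom_bdB _ _ _ B)[_ _ _ ->].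
apply/eqP; apply: contraNT c; rewrite ent_imx raddf_sum /= => nz.
have [a /andP[sa /eqP tE]|none] := pickP [pred a in s | t == s :\ a];
  last first.
  by rewrite big_pred0 ?eqxx in nz.
have ts : t \subset s by rewrite tE subsetDl.
have : mcoeff 0%MM (taylor_weight s t) != 0.
  apply: contraNneq nz => nz; rewrite big1 // => b _.
  by rewrite sgn_mcoeff nz mulr0.
rewrite mcoeffX; have [m0 _|_] := eqVneq _ 0%MM; last by rewrite eqxx.
rewrite eqEsubset (coverS ts) andbT; apply/subsetP => x xs.
have [u xu] := cover_sub_iota sB xs.
move/mnmP/(_ (enum_rank u)): m0; rewrite mnmBE !mnmE enum_rankK -xu xs.
by case: (x \in cover t).
Qed.

Fact taylorB_key : unit. Proof. by []. Qed.
Definition taylorB : tmat := locked_with taylorB_key (onBR *m taylor).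

Lemma taylorBE : taylorB = onBR *m taylor.
Proof. by rewrite /taylorB locked_withE. Qed.

Lemma ent_taylorB s t : ent taylorB s t =
  if s \subset B then ent taylor s t else 0.
Proof. by rewrite taylorBE entMpl. Qed.

Lemma taylorB_neq0 s t : ent taylorB s t != 0 ->
  [/\ s \subset B, t \subset B, deg s = (deg t).+1 & cover t \subset cover s].
Proof.
rewrite ent_taylorB; case: ifP => [sB|]; last by rewrite eqxx.
by case/taylor_neq0=> ts c cc; split=> //; apply: subset_trans ts sB.
Qed.

Lemma onBR_taylorB : onBR *m taylorB = taylorB.
Proof.
apply: ent_inj => s t; rewrite entMpl /=; case: ifPn => // sB.
by rewrite ent_taylorB (negPf sB).
Qed.

Lemma taylorB_onBR : taylorB *m onBR = taylorB.
Proof.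
apply: ent_inj => s t; rewrite entMpr /=; case: ifPn => // tB.
by apply/esym/eqP; apply: contraNT tB => /taylorB_neq0[].
Qed.

Lemma grade_onBR i : grade_mx i *m onBR = grade_mx i.
Proof.
apply: ent_inj => s t; rewrite entMpr ent_pmx /=; case: ifPn => // tB.
by case: eqP => [->|_] //=; rewrite (negPf tB).
Qed.

Lemma grade_taylorB i : grade_mx i *m taylorB = grade_mx i *m taylor.
Proof. by rewrite taylorBE mulmxA grade_onBR. Qed.

Lemma taylorB_taylorB : taylorB *m taylorB = 0.
Proof.
by rewrite {2}taylorBE mulmxA taylorB_onBR taylorBE -mulmxA taylor_taylor
  mulmx0.
Qed.

Lemma grade_idem i : grade_mx i *m grade_mx i = grade_mx i.
Proof. exact: pmx_idem. Qed.

Lemma taylorB_grade i : taylorB *m grade_mx i = grade_mx i.+1 *m taylorB.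
Proof.
apply: ent_inj => s t; rewrite entMpr entMpl /=.
have [->|/taylorB_neq0[-> -> -> _]] := eqVneq (ent taylorB s t) 0.
  by rewrite !if_same.
by rewrite eqSS.
Qed.

(** * Lifting the scalar homotopy to the Taylor complex *)

Section Defect.
Variables (n : nat) (T0 p : 'M[k]_#|{set {set G}}|).
Hypothesis T0p : homology_splitting r B T0 p.
Hypothesis p_top : forall s t, ent p s t != 0 -> (deg s <= n)%N.

Let T := lift_mx T0.

Let defect : tmat := onBR - (taylorB *m T + T *m taylorB).

Lemma liftT_neq0 s t : ent T s t != 0 -> shift_rel B 0 1 s t.
Proof.
have [hT _ _ _ _] := T0p.
by rewrite ent_lift; apply: contraNP => /(contra_not (hT s t)) /negP;
  rewrite negbK => /eqP ->; rewrite rmorph0.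
Qed.

Lemma defect_neq0 s t : ent defect s t != 0 ->
  [/\ s \subset B, t \subset B, deg s = deg t & cover t \subset cover s].
Proof.
rewrite entD entN entD => nz.
have [DT0|/entM_neq0[u]] := eqVneq (ent (taylorB *m T) s t) 0; last first.
  by move=> /taylorB_neq0[sB uB c cc] /liftT_neq0[_ tB c' <-]; split=> //; lia.
have [TD0|/entM_neq0[u]] := eqVneq (ent (T *m taylorB) s t) 0; last first.
  by move=> /liftT_neq0[sB uB c ->] /taylorB_neq0[_ tB c' cc]; split=> //; lia.
move: nz; rewrite DT0 TD0 addr0 subr0 ent_pmx /=.
have [<-|_] := eqVneq s t; last by rewrite eqxx.
by have [sB|_] := boolP (s \subset B); rewrite ?eqxx.
Qed.

(** [T] preserves covers, so between faces of equal cover only the cover-preserving entries of the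
    Taylor differential enter, and these are the scalar ones. *)
Lemma defect_cover_eq s t : s \subset B -> cover s = cover t ->
  ent defect s t = (ent p s t)%:MP.
Proof.
move=> sB c; have [hT _ E _ _] := T0p.
have -> : p = onB k B - (bdB k r B *m T0 + T0 *m bdB k r B).
  by rewrite E opprB addrC subrK.
rewrite !(entD, entN) ent_onB ent_pmx /= rmorphD rmorphN rmorphD /=.
rewrite rmorph_nat; congr (_ - (_ + _)); rewrite !entM rmorph_sum /=.
  apply: eq_bigr => u _; rewrite ent_lift rmorphM /=.
  have [->|/hT[uB _ _ cu]] := eqVneq (ent T0 u t) 0;
    first by rewrite rmorph0 !mulr0.
  by rewrite ent_taylorB sB taylor_cover_eq // c.
apply: eq_bigr => u _; rewrite ent_lift rmorphM /=.
have [->|/hT[_ uB _ cu]] := eqVneq (ent T0 s u) 0;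
  first by rewrite rmorph0 !mul0r.
by rewrite ent_taylorB uB taylor_cover_eq // -cu.
Qed.

(** Above degree [n] the projection [p] has no entries, so the defect has none between faces of
    equal cover. *)
Lemma defect_lt s t : (n < deg s)%N -> ent defect s t != 0 ->
  (#|cover t| < #|cover s|)%N.
Proof.
move=> lt nz; have [sB tB _ c] := defect_neq0 nz; apply: proper_card.
rewrite properEneq c andbT; apply: contraNneq nz => e.
rewrite defect_cover_eq //; have [->|/p_top] := eqVneq (ent p s t) 0.
  by rewrite rmorph0.
by rewrite leqNgt lt.
Qed.

Lemma defect_pow_neq0 j s t : (n < deg s)%N ->
  ent (iter j (mulmx defect) onBR) s t != 0 -> (#|cover t| + j <= #|cover s|)%N.
Proof.
elim: j s => [|j IHj] s lt /=.
  by rewrite ent_pmx; have [->|_] := eqVneq s t; rewrite ?addn0 ?eqxx.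
move=> /entM_neq0[u nz /IHj]; have [_ _ e _] := defect_neq0 nz.
by rewrite -e => /(_ lt) le; have := defect_lt lt nz; lia.
Qed.

(** Each application of the defect loses a vertex of the cover, and a cover has at most [#|G|]
    vertices; hence the power [#|G|.+1] vanishes in degree [n.+1]. *)
Lemma contraction_above : exists T',
  grade_mx n.+1 *m (taylorB *m T' + T' *m taylorB) = grade_mx n.+1.
Proof.
have iT : onBR *m T = T.
  apply: ent_inj => s t; rewrite entMpl /=; case: ifPn => // sB.
  by apply/esym/eqP; apply: contraNT sB => /liftT_neq0[].
have II : onBR *m onBR = onBR by apply: pmx_idem.
have [T' E'] := homotopy_iterate #|G|.+1 II onBR_taylorB taylorB_onBR iT
  taylorB_taylorB.
exists T'; rewrite E' mulmxBr grade_onBR -/defect.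
set pow := iter _ _ _; have -> : grade_mx n.+1 *m pow = 0;
  last by rewrite subr0.
apply: ent_inj => s t; rewrite ent0 entMpl /=; case: ifP => // /andP[_ /eqP ds].
apply/eqP; apply: contraT => /defect_pow_neq0; rewrite ds => /(_ (leqnn _)).
by move/leq_trans/(_ (max_card _)); rewrite addnS ltnNge leq_addl.
Qed.

End Defect.
Lemma grade_taylorB_ex0 (eps : {linear 'rV[R]_#|{set {set G}}| ->
  edge_ring k H})
    (v : 'rV[R]_#|{set {set G}}|) :
  (forall v, eps v = 0 <-> vent v set0 \in @edge_ideal k H) ->
  v *m grade_mx 0 = v -> eps v = 0 ->
  exists w : 'rV[R]_#|{set {set G}}|, w *m grade_mx 1 *m taylorB = v.
Proof.
move=> eps0 v0 /eps0 vI.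
have vD : v *m taylor = 0.
  rewrite -v0; apply: vent_inj => t;
    rewrite ventM [RHS]/vent mxE big1 // => s _.
  rewrite ventMp /=; case: ifP => [/andP[_ /eqP s0]|]; last by rewrite mul0r.
  have [->|/taylor_neq0[_ c _]] := eqVneq (ent taylor s t) 0;
    first by rewrite mulr0.
  by rewrite c in s0.
have [|w wE] := taylor_exact v0 vD.
  by move=> _ m nz; apply: edge_ideal_coef vI nz.
by exists w; rewrite -mulmxA grade_taylorB mulmxA.
Qed.

Lemma grade_taylorB_ex i (v : 'rV[R]_#|{set {set G}}|) :
  v *m grade_mx i.+1 = v -> v *m taylorB = 0 ->
  exists w : 'rV[R]_#|{set {set G}}|, w *m grade_mx i.+2 *m taylorB = v.
Proof.
move=> vi vD; have [||w wE] := taylor_exact vi _ => //.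
  by rewrite -vi -mulmxA -grade_taylorB mulmxA vi vD.
by exists w; rewrite -mulmxA grade_taylorB mulmxA.
Qed.

Lemma augmentation_grade : exists eps : {linear 'rV[R]_#|{set {set G}}| ->
  edge_ring k H},
  [/\ forall x, exists v : 'rV[R]_#|{set {set G}}|, eps (v *m grade_mx 0) = x,
      forall v : 'rV[R]_#|{set {set G}}|, eps (v *m grade_mx 1 *m taylorB) = 0 &
      forall v : 'rV[R]_#|{set {set G}}|, v *m grade_mx 0 = v -> eps v = 0 ->
        exists w : 'rV[R]_#|{set {set G}}|, w *m grade_mx 1 *m taylorB = v].
Proof.
have [eps [surj eps0]] := augmentation; exists eps; split.
- move=> x; have [c cE] := surj x; exists (\row_i c); apply: cE.
  by rewrite ventMp /= sub0set /deg cards0 /vent mxE.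
- move=> v; apply/eps0; rewrite -mulmxA grade_taylorB mulmxA.
  exact: taylor_row_ideal.
- by move=> v; apply: grade_taylorB_ex0.
Qed.

Lemma grade_taylorB_grade i : grade_mx i.+1 *m taylorB *m grade_mx i =
  grade_mx i.+1 *m taylorB.
Proof. by rewrite -mulmxA taylorB_grade mulmxA grade_idem. Qed.

Lemma edge_ring_resolution n : homology_top k r B n ->
  has_projective_resolution (edge_ring k H) n.
Proof.
move=> [T0 [p [T0p _ ub]]].
have [T' E] := contraction_above T0p ub.
have [eps [surj epsD ex0]] := augmentation_grade.
(* [T'] is cut down to its part from degree [n] to degree [n.+1], as the truncation requires. *)
apply: (truncated_resolution (T := grade_mx n *m T' *m grade_mx n.+1) grade_idem
  grade_taylorB_grade taylorB_taylorB surj epsD ex0 grade_taylorB_ex).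
  by rewrite !mulmxA grade_idem -mulmxA grade_idem.
have tE : grade_mx n.+1 *m taylorB *m T' *m taylorB = grade_mx n.+1 *m taylorB.
  rewrite -[RHS](congr1 (mulmx^~ taylorB) E) mulmxDr mulmxDl !mulmxA.
  by rewrite -[X in _ = _ + X]mulmxA taylorB_taylorB mulmx0 addr0.
transitivity (grade_mx n.+1 *m taylorB *m T' *m taylorB *m grade_mx n).
  by rewrite -[RHS]mulmxA taylorB_grade !mulmxA grade_taylorB_grade.
by rewrite tE grade_taylorB_grade.
Qed.

Lemma map_grade_mod0 i : map_mx (mcoeff 0%MM) (grade_mx i) =
  pmx k [pred s : {set {set G}} | (s \subset B) && (deg s == i)].
Proof. exact: map_pmx. Qed.

Lemma map_taylorB_mod0 : map_mx (mcoeff 0%MM) taylorB = bdB k r B.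
Proof.
apply: ent_inj => s t; rewrite ent_map ent_taylorB ent_bdB.
by case: ifP => sB; rewrite ?rmorph0 // taylor_mod0 // ent_bdB sB.
Qed.

(** A shorter resolution contracts the Taylor complex in degree [n]. Reduced modulo the variables
    and placed between two copies of [p], the contraction vanishes because [p D = D p = 0]; but [p]
    has a nonzero entry in that degree. *)
Lemma edge_ring_no_resolution n m : homology_top k r B n -> (m < n)%N ->
  ~ has_projective_resolution (edge_ring k H) m.
Proof.
move=> [T0 [p [[hT0 hp E [pD Dp] pp] [s [t [ds nz]]] _]]] ltmn res.
have [eps [surj epsD ex0]] := augmentation_grade.
case: n ltmn ds => // n; rewrite ltnS => lemn ds.
have [|S [S' SE]] := matrix_contraction grade_idem
  grade_taylorB_grade _ surj epsD ex0 grade_taylorB_ex res lemn.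
  by move=> i; rewrite -mulmxA taylorB_taylorB mulmx0.
pose g := pmx k [pred s : {set {set G}} | (s \subset B) && (deg s == n.+1)].
have gE : g = g *m map_mx (mcoeff 0%MM) S *m bdB k r B +
     g *m bdB k r B *m map_mx (mcoeff 0%MM) S'.
  have := congr1 (map_mx (mcoeff 0%MM)) SE.
  by rewrite map_mxD !map_mxM map_taylorB_mod0 map_grade_mod0.
have pg : p *m g = g *m p.
  apply: ent_inj => u v; rewrite entMpr entMpl /=.
  have [->|/hp[-> -> c _]] := eqVneq (ent p u v) 0; first by rewrite !if_same.
  by rewrite !addn0 in c; rewrite c.
have : ent (p *m g *m p) s t = 0.
  rewrite {1}gE mulmxDr mulmxDl -!mulmxA Dp !mulmx0 add0r.
  by rewrite mulmxA pg -mulmxA [p *m _]mulmxA pD mul0mx mulmx0 ent0.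
rewrite pg -mulmxA pp entMpl /=; have [-> _ _ _] := hp _ _ nz.
by rewrite ds eqxx => /eqP; rewrite (negPf nz).
Qed.

(** The preceding bounds determine the minimal length. The label order [r] and the embedding [iota]
    are free, so they can be adapted to each application. *)
Lemma graph_proj_dim_homology n : homology_top k r B n ->
  graph_proj_dim k H = n.
Proof.
move=> top; rewrite /graph_proj_dim /proj_dim; case: pselect => [ex|none].
  case: ex_minnP => m /asboolP res mmin; apply/eqP; rewrite eqn_leq.
  rewrite mmin; last by apply/asboolP; apply: edge_ring_resolution.
  by rewrite leqNgt; apply/negP => /(edge_ring_no_resolution top).
case: none; exists n; apply/asboolP; exact: edge_ring_resolution.
Qed.

End Taylor.

(** * Projective dimension of induced subgraphs *)
Section InducedProjDim.
Variables (k : fieldType) (G : sgraph).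
Implicit Types (S W : {set G}) (D E : {set {set G}}).

Definition pd S : nat := graph_proj_dim k (induced S).

Definition non_adjacent S1 S2 : Prop :=
  forall x y, x \in S1 -> y \in S2 -> ~~ edge x y.

Lemma edge_setsN0 S : set0 \notin edge_sets S.
Proof.
apply/edge_setsP => -[x [y [_ /setP/(_ x)]]].
by rewrite !inE eqxx.
Qed.

Lemma pd_homology (r : {set G} -> nat) S n : injective r ->
  homology_top k r (edge_sets S) n -> pd S = n.
Proof.
move=> rI top; apply: (@graph_proj_dim_homology k G (induced S) val r) => //.
  exact: val_inj.
suff -> : [set val u | u in induced S] = S by [].
apply/setP => x; apply/imsetP/idP => [[u _ ->]|xS]; first exact: valP.
by exists (exist _ x xS).
Qed.

Definition rank (a : {set G}) : nat := enum_rank a.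

Lemma rank_inj : injective rank.
Proof. by move=> a b /ord_inj/enum_rank_inj. Qed.

Lemma pd_homology_top (r : {set G} -> nat) S : injective r ->
  homology_top k r (edge_sets S) (pd S).
Proof.
move=> rI; have [n top] := homology_top_exists k rI (edge_setsN0 S).
by rewrite (pd_homology rI top).
Qed.

(** Both sides are computed by the same scalar complex in [G]; this identifies iterated induced
    subgraphs with vertex sets of [G]. *)
Lemma graph_proj_dim_embedding (H : sgraph) (iota : H -> G) :
  injective iota -> (forall u v, edge (iota u) (iota v) = edge u v) ->
  graph_proj_dim k H = pd [set iota u | u in H].
Proof.
move=> iI ie; apply: (graph_proj_dim_homology iI ie rank_inj).
exact: pd_homology_top rank_inj.
Qed.

Lemma pd_setT : pd [set: G] = graph_proj_dim k G.
Proof.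
rewrite (@graph_proj_dim_embedding G id) //; congr pd.
by apply/setP => x; rewrite inE; apply/esym/imsetP; exists x.
Qed.

Lemma pd_delete_vertex S (x : induced S) :
  graph_proj_dim k (delete_vertex x) = pd (S :\ val x).
Proof.
rewrite (@graph_proj_dim_embedding (delete_vertex x) (fun u => val (val u))) //.
  congr pd; apply/setP => y; rewrite in_setD1; apply/imsetP/andP.
    move=> [u _ ->]; split; last exact: valP.
    by have := valP u; rewrite !inE; apply: contraNneq => /val_inj ->.
  move=> [yx yS]; have ux : exist _ y yS \in [set~ x] :> bool.
    by rewrite !inE; apply: contraNneq yx => <-.
  by exists (exist _ (exist _ y yS) ux).
by move=> u v /val_inj/val_inj.
Qed.

(** The saturation hypothesis holds because an edge is contained in the cover of any face it belongs
    to: if that cover lies in [S1], so does the edge. *)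
Lemma pdS S1 S2 : S1 \subset S2 -> (pd S1 <= pd S2)%N.
Proof.
move=> S12; apply: (homology_top_mono (k := k) (r := rank) (B := edge_sets S1)
  (B' := edge_sets S2)); try exact: pd_homology_top rank_inj.
  apply/subsetP => a /edge_setsP[x [y [xy aE aS]]]; apply/edge_setsP.
  by exists x, y; split=> //; apply: subset_trans S12.
move=> s t s2 t1 c; apply/subsetP => a sa.
have /edge_setsP[x [y [xy aE _]]] := subsetP s2 a sa.
apply/edge_setsP; exists x, y; split=> //.
have : a \subset cover s by apply: bigcup_sup.
rewrite c => /subset_trans; apply; apply/bigcupsP => b /(subsetP t1).
by case/edge_setsP=> [_ [_ [_ _]]].
Qed.

Lemma pdU S1 S2 : [disjoint S1 & S2] -> non_adjacent S1 S2 ->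
  pd (S1 :|: S2) = (pd S1 + pd S2)%N.
Proof.
move=> dis nadj.
have [N rN] : exists N, forall a : {set G}, (rank a < N)%N.
  by eexists => a; apply: ltn_ord.
(* All labels outside [edge_sets S1] are shifted by [N], past every label of [S1], as the tensor
   decomposition demands. *)
pose r a := (rank a + if a \in edge_sets S1 then 0 else N)%N.
have rI : injective r.
  move=> a b; rewrite /r => eab; apply: rank_inj; move: eab.
  by have := rN a; have := rN b; do 2!case: ifP => _; lia.
have dab a b : a \in edge_sets S1 -> b \in edge_sets S2 -> [disjoint a & b].
  move=> /edge_setsP[_ [_ [_ _ aS]]] /edge_setsP[_ [_ [_ _ bS]]].
  exact: disjointWl aS (disjointWr bS dis).
have a12 a : a \in edge_sets S1 -> a \notin edge_sets S2.
  move=> a1; apply/negP => /(dab _ _ a1); rewrite -setI_eq0 setIid => /eqP a0.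
  by have := edge_setsN0 S1; rewrite -a0 a1.
apply: (pd_homology rI).
have -> : edge_sets (S1 :|: S2) = edge_sets S1 :|: edge_sets S2.
  apply/setP => a; rewrite in_setU; apply/edge_setsP/orP.
    move=> [x [y [xy ->]]]; rewrite subUset !sub1set 2!in_setU.
    move=> /andP[/orP[x1|x2] /orP[y1|y2]].
    - by left; apply/edge_setsP; exists x, y; rewrite subUset !sub1set x1 y1 xy.
    - by have := nadj x y x1 y2; rewrite xy.
    - by have := nadj y x y1 x2; rewrite edge_sym xy.
    - by right; apply/edge_setsP; exists x, y;
      rewrite subUset !sub1set x2 y2 xy.
  case=> /edge_setsP[x [y [xy aE aS]]]; exists x, y; split=> //.
    by apply: subset_trans aS (subsetUl _ _).
  by apply: subset_trans aS (subsetUr _ _).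
apply: homology_top_tens => //; try exact: pd_homology_top rI.
- by rewrite disjoints_subset; apply/subsetP => a /a12; rewrite in_setC.
- move=> a b a1 b2; rewrite /r a1 ifN; last by apply: contraL b2 => /a12.
  by have := rN a; lia.
Qed.

Lemma pd1 x : pd [set x] = 0%N.
Proof.
have B0 : edge_sets [set x] = set0.
  apply/setP => a; rewrite [RHS]inE; apply/edge_setsP => -[y [z [yz ->]]].
  rewrite subUset !sub1set !inE => /andP[/eqP yx /eqP zx].
  by rewrite yx zx edge_irr in yz.
apply: (pd_homology rank_inj); rewrite -[0%N](@cards0 {set G}) -B0.
by apply: homology_top_small; rewrite ?edge_setsN0 // B0 cards0.
Qed.

(** A single edge has projective dimension one, and monotonicity does the rest. *)
Lemma pd_gt0 S x y : x \in S -> y \in S -> edge x y -> (0 < pd S)%N.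
Proof.
move=> xS yS xy; apply: leq_trans (_ : pd [set x; y] <= _)%N; last first.
  by apply: pdS; rewrite subUset !sub1set xS yS.
have B1 : edge_sets [set x; y] = [set [set x; y]].
  apply/setP => a; rewrite [RHS]inE; apply/edge_setsP/eqP => [|->]; last first.
    by exists x, y.
  move=> [u [v [uv ->]]] sub; apply/eqP; rewrite eqEcard sub !cards2.
  have -> : u != v by apply: contraTneq uv => ->; rewrite edge_irr.
  by case: (x != y).
rewrite (pd_homology (n := 1) rank_inj) //.
rewrite -[1%N](cards1 [set x; y]) -B1.
by apply: homology_top_small; rewrite ?edge_setsN0 // B1 cards1.
Qed.

(** The conditions that yield additivity, shared by the connected components of a set and by induced
    families. *)
Definition separated D : Prop := trivIset D /\
  forall x y, x \in cover D -> y \in cover D -> edge x y ->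
    exists2 S, S \in D & (x \in S) && (y \in S).

Lemma trivIset_eq D S1 S2 x : trivIset D -> S1 \in D -> S2 \in D ->
  x \in S1 -> x \in S2 -> S1 = S2.
Proof.
move=> tD D1 D2 x1 x2.
by rewrite -(def_pblock tD D1 x1) (def_pblock tD D2 x2).
Qed.

Lemma separated_split D S : separated D -> S \in D ->
  [/\ cover D = S :|: cover (D :\ S), [disjoint S & cover (D :\ S)] &
      non_adjacent S (cover (D :\ S))].
Proof.
move=> [tD sD] DS.
have coverE : cover D = S :|: cover (D :\ S) by rewrite /cover (big_setD1 S).
split=> //.
  rewrite disjoints_subset; apply/subsetP => x xS; rewrite inE.
  apply/negP => /bigcupP[S']; rewrite !inE => /andP[nS' DS'] xS'.
  by case/eqP: nS'; apply: trivIset_eq tD DS' DS xS' xS.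
move=> x y xS yC; apply/negP => xy.
have [||S' DS' /andP[xS' yS']] := sD x y _ _ xy.
- by rewrite coverE inE xS.
- by rewrite coverE inE yC orbT.
move/bigcupP: yC => [S'']; rewrite !inE => /andP[/eqP nS'' DS''] yS'';
  apply: nS''.
by rewrite (trivIset_eq tD DS'' DS' yS'' yS') (trivIset_eq tD DS' DS xS' xS).
Qed.

Lemma separatedS D E : separated D -> E \subset D -> separated E.
Proof.
move=> [tD sD] ED; have tE := trivIsetS ED tD; split=> //.
move=> x y /bigcupP[S ES xS] /bigcupP[S' ES' yS'] xy.
have [||S0 DS0 /andP[xS0 yS0]] := sD x y _ _ xy.
- by apply/bigcupP; exists S => //; apply: (subsetP ED).
- by apply/bigcupP; exists S' => //; apply: (subsetP ED).
exists S0; rewrite ?xS0 ?yS0 //.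
by rewrite (trivIset_eq tD DS0 (subsetP ED _ ES) xS0 xS).
Qed.

Lemma pd_cover D : separated D -> pd (cover D) = (\sum_(S in D) pd S)%N.
Proof.
have [n] := ubnP #|D|; elim: n D => // n IHn D; rewrite ltnS => leD sD.
have [->|[S DS]] := set_0Vmem D.
  (* For the empty family the value at [set0] is bounded by that of a vertex, or computed directly
     when [G] has no vertex. *)
  rewrite big_set0 /cover big_set0; have [x|noV] := pickP (@predT G).
    by move=> _; apply/eqP; rewrite -leqn0 -(pd1 x) pdS ?sub0set.
  apply: (pd_homology rank_inj); have B0 : edge_sets (set0 : {set G}) = set0.
    apply/setP => a; rewrite [RHS]inE; apply/edge_setsP => -[y].
    by have := noV y.
  rewrite -[0%N](@cards0 {set G}) -B0.
  by apply: homology_top_small; rewrite ?edge_setsN0 // B0 cards0.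
have [-> dis nadj] := separated_split sD DS.
rewrite pdU // (big_setD1 S) //= IHn //.
  by rewrite (cardsD1 S) DS in leD.
exact: separatedS sD (subsetDl _ _).
Qed.

End InducedProjDim.

(** * Connected components of an induced subgraph *)

Section Components.
Variables (G : sgraph) (W : {set G}).

(** A relation on all of [G], so that the components are vertex sets of [G] and not of a subtype. *)
Definition edge_in : rel G := fun x y => [&& edge x y, x \in W & y \in W].

Definition components : {set {set G}} :=
  equivalence_partition (connect edge_in) W.

Lemma edge_in_sym : connect_sym edge_in.
Proof.
by apply: sym_connect_sym => x y;
  rewrite /edge_in edge_sym [(y \in W) && _]andbC.
Qed.

Lemma connect_edge_in_equiv : {in W & &, equivalence_rel (connect edge_in)}.
Proof.
move=> x y z _ _ _; split=> [|xy]; first exact: connect0.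
exact: same_connect edge_in_sym _ _ xy z.
Qed.

Lemma componentsP : partition components W.
Proof. exact: equivalence_partitionP connect_edge_in_equiv. Qed.

Lemma mem_component S x y : S \in components -> x \in S -> y \in W ->
  (y \in S) = connect edge_in x y.
Proof.
have /and3P[/eqP cov tD _] := componentsP => DS xS yW.
have xW : x \in W by rewrite -cov; apply/bigcupP; exists S.
by rewrite -(def_pblock tD DS xS) (pblock_equivalence_partition
  connect_edge_in_equiv).
Qed.

Lemma component_sub S : S \in components -> S \subset W.
Proof.
have /and3P[/eqP cov _ _] := componentsP => DS.
by rewrite -cov; apply: bigcup_sup.
Qed.

Lemma connect_induced (S : {set G}) x p (xS : x \in S) :
  (forall u v, u \in S -> edge_in u v -> v \in S) -> path edge_in x p ->
  forall yS : last x p \in S,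
  connect (@edge (induced S)) (exist _ x xS) (exist _ (last x p) yS).
Proof.
move=> clos; elim: p x xS => [|z p IHp] x xS /= => [_ yS|/andP[xz zp] yS].
  by rewrite (bool_irrelevance yS xS) connect0.
have zS := clos _ _ xS xz.
apply: connect_trans (connect1 _) (IHp z zS zp yS).
by rewrite /= /induced_edge /=; case/and3P: xz.
Qed.

Lemma component_connected S : S \in components -> connected_graph (induced S).
Proof.
move=> DS; have /and3P[/eqP cov tD nD] := componentsP; split.
  have /set0Pn[x xS] : S != set0 by apply: contraNneq nD => <-.
  by apply/card_gt0P; exists (exist _ x xS).
have clos u v : u \in S -> edge_in u v -> v \in S.
  move=> uS uv; rewrite (mem_component DS uS) ?connect1 //.
  by case/and3P: uv.
move=> [x xS] [y yS].
have : connect edge_in x y.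
  by rewrite -(mem_component DS xS) // (subsetP (component_sub DS)).
case/connectP=> p xp yE; move: yS; rewrite yE => yS.
exact: connect_induced.
Qed.

Lemma components_separated : separated components.
Proof.
have /and3P[/eqP cov tD _] := componentsP; split=> // x y.
rewrite cov => xW yW xy; have : x \in cover components by rewrite cov.
case/bigcupP=> S DS xS; exists S => //; rewrite xS (mem_component DS xS) //.
by apply: connect1; rewrite /edge_in xy xW.
Qed.

End Components.

(** * Attaining the maximum *)

Lemma induced_family_separated (G : sgraph) (D : {set {set G}}) :
  induced_family D -> separated D.
Proof. by case. Qed.

Lemma connected_has_edge (G : sgraph) (S : {set G}) :
  (2 <= #|S|)%N -> connected_graph (induced S) ->
  exists x y, [/\ x \in S, y \in S & edge x y].
Proof.
move=> /card_gt1P[x [y [xS yS xy]]] [_ conn].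
have /connectP[[|z p] /= ] := conn (exist _ x xS) (exist _ y yS).
  by move=> _ [yx]; rewrite yx eqxx in xy.
by move=> /andP[xz _] _; exists x, (val z); split=> //; apply: valP.
Qed.

Theorem theorem5p5 (k : fieldType) (G : sgraph) :
  is_maximum
    (fun m : nat => exists D : {set {set G}},
       projectively_prime_decomposition k D /\
       m = (\sum_(S in D) graph_proj_dim k (induced S))%N)
    (graph_proj_dim k G).
Proof.
have sum_le (D : {set {set G}}) : separated D ->
    (\sum_(S in D) pd k S <= pd k [set: G])%N.
  by move=> sD; rewrite -pd_cover // pdS ?subsetT.
split; last first.
  move=> _ [D [[[/induced_family_separated sD _] _] ->]].
  by rewrite -pd_setT; apply: sum_le.
pose P := fun W : {set G} => pd k W == pd k [set: G].
(* A smallest vertex set with full projective dimension; by monotonicity, deleting any of its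
   vertices lowers the value. *)
have [W /eqP pdW Wmin] : exists2 W, P W & forall W', P W' -> (#|W| <= #|W'|)%N.
  by case: (arg_minnP (P :=
    P) (fun W : {set G} => #|W|) (eqxx _ : P setT)) => W; exists W.
have pdWx x : x \in W -> (pd k (W :\ x) < pd k W)%N.
  move=> xW; rewrite ltn_neqAle pdS ?subsetDl // andbT.
  apply/eqP; rewrite pdW => e; have /Wmin : P (W :\ x) by apply/eqP.
  by rewrite (cardsD1 x W) xW add1n ltnn.
have /and3P[/eqP cov tD nD] := componentsP W.
have sD := components_separated W.
have split S : S \in components W -> exists C : {set G},
    [/\ W = S :|: C, [disjoint S & C] & non_adjacent S C].
  move=> DS; have [cE dis nadj] := separated_split sD DS.
  by exists (cover (components W :\ S)); rewrite -[LHS]cov.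
(* Deleting [x] changes only the component [S] of [W], so by additivity the strict drop for [W] is
   one for [S]. *)
have prime S x : S \in components W -> x \in S -> (pd k (S :\ x) < pd k S)%N.
  move=> DS xS; have [C [WE dis nadj]] := split S DS.
  have xW : x \in W by rewrite WE inE xS.
  have := pdWx x xW.
  have -> : W :\ x = (S :\ x) :|: C.
    rewrite WE setDUl; congr (_ :|: _); apply/setDidPl.
    by rewrite disjoint_sym disjoints1 (disjointFr dis xS).
  rewrite WE !pdU ?ltn_add2r //.
    exact: disjointWl (subsetDl _ _) dis.
  by move=> u v; rewrite inE => /andP[_ uS]; apply: nadj.
have fam : induced_family (components W).
  split=> // [S DS|S DS|]; last by case: sD.
    have /set0Pn[x xS] : S != set0 by apply: contraNneq nD => <-.
    (* A one-vertex component has value zero, which leaves no room for a strict drop. *)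
    rewrite ltnNge; apply/negP => S1.
    have Sx : S = [set x] by apply/eqP;
      rewrite eq_sym eqEcard sub1set xS cards1.
    by have := prime S x DS xS; rewrite Sx pd1.
  exact: component_connected DS.
exists (components W); split; last first.
  by rewrite -pd_setT -pdW -{1}cov pd_cover.
split; first split=> //.
  (* A member [S] outside the components contains an edge, hence has positive value; the sum over
     [D'] would exceed the value of [G], already reached by the components. *)
  move=> D' fam' sub; apply/eqP; rewrite eqEsubset sub andbT.
  apply/subsetP => S D'S; apply: contraT => nS.
  have [tD' card2 conn _] := fam'.
  have [x [y [xS yS xy]]] := connected_has_edge (card2 S D'S) (conn S D'S).
  have := sum_le D' (induced_family_separated fam').
  rewrite -pdW -cov pd_cover // (big_setID (components W)) /=.
  rewrite (setIidPr sub) (big_setD1 S (A := D' :\: components W)) /=;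
    last first.
    by rewrite inE nS.
  rewrite -[leqRHS]addn0 leq_add2l leqn0 addn_eq0 => /andP[/eqP pd0 _].
  by have := pd_gt0 k xS yS xy; rewrite pd0.
move=> S DS; split=> [|x]; first exact: component_connected DS.
by rewrite pd_delete_vertex; apply: prime => //; apply: valP.
Qed.
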